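(* Let $G$ and $G'$ be finitely generated groups and let $f\colon \mathcal{C}(G) \to \mathcal{C}(G')$ be a quasi-isometry. Suppose that $H$ is a subgroup of $G$ such that $\tilde{e}(G,H) \geq 3$, and such that for every infinite index subgroup $K$ of $H$, $\tilde{e}(G,K)=1$. If sufficiently large uniform neighborhoods of $f(H)$ in $\mathcal{C}(G')$ satisfy the noncrossing condition (i.e. there is $R_0\ge 0$ such that $N_R(f(H))$ satisfies the noncrossing condition for all $R\ge R_0$), then $G'$ contains a subgroup $H'$ such that $$d_{Haus}(H', f(H))<\infty.$$ In addition, $H$ is finitely generated if and only if $H'$ is finitely generated, and in this case $H$ is quasi-isometric to $H'$.
   Context: Every finitely generated group $G$ comes with a fixed finite generating set. $\mathcal{C}(G)$ is its Cayley graph: vertex set $G$, with $g,g'$ joined by an edge iff $g'=gs$ where $s$ or $s^{-1}$ is a generator; edges have length one. $G$ acts on $\mathcal{C}(G)$ by isometries on the left. Subgroups are regarded as sets of vertices. $d_{Haus}$ is Hausdorff distance. Finitely generated groups are quasi-isometric if they are so with respect to their own word metrics. In a metric space $X$, $N_r(Y)=\{x: d(x,Y)\le r\}$; a uniform neighborhood of $Y$ is a set $N_r(Y)$, $r\ge0$. A component of $X-Z$ is shallow if it is contained in some uniform neighborhood of $Z$, and deep otherwise. If a group $G$ acts on $X$, a subset $Y\subseteq X$ satisfies the noncrossing condition if there is $k>0$ such that for every two distinct members $Y_1\ne Y_2$ of $\{gY\}_{g\in G}$, $Y_1$ is contained in the $k$-neighborhood of some deep component of $X-Y_2$. Number of coends: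 for a subgroup $H$ of a finitely generated group $G$, a subset of $G$ is $H$-finite if it is contained in finitely many cosets $Hg$. Let $\mathcal{P}(G)$ be the power set of $G$ and $\mathcal{F}_H(G)$ the set of $H$-finite subsets; under symmetric difference $\mathcal{P}(G)/\mathcal{F}_H(G)$ is a vector space over the two-element field $\mathbb{F}_2$, on which $G$ acts on the right. Then $\tilde e(G,H)=\dim_{\mathbb{F}_2}(\mathcal{P}(G)/\mathcal{F}_H(G))^G$, where the superscript denotes the fixed subspace (classes of $X$ such that the symmetric difference of $X$ and $Xg$ is $H$-finite for all $g\in G$). *)

(* Defs.v *)
From HB Require Import structures.
From mathcomp Require Import all_boot all_order all_algebra.
From mathcomp Require Import all_classical all_reals all_analysis.
From mathcomp Require Import ring.

Set Implicit Arguments.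
Unset Strict Implicit.
Unset Printing Implicit Defensive.

Import Order.TTheory GRing.Theory Num.Theory.

Local Open Scope classical_set_scope.
Local Open Scope quotient_scope.
Local Open Scope ring_scope.

Section Metric.
Context {R : realType} {X : metricType R}.
Implicit Types (Y Z C : set X) (r k : R).

(* The distance to the empty set is [+oo]. *)
Definition dist_to (x : X) Y : \bar R := ereal_inf [set (mdist x y)%:E | y in Y].

Definition unif_nbhd r Y : set X := [set x | (dist_to x Y <= r%:E)%E].

Definition hausdorff_dist Y Z : \bar R :=
  ereal_inf [set r%:E | r in
    [set r | [/\ 0 <= r, Y `<=` unif_nbhd r Z & Z `<=` unif_nbhd r Y]]].

Definition is_component (A C : set X) :=
  exists2 x, A x & C = connected_component A x.

Definition shallow Z C := exists2 r, 0 <= r & C `<=` unif_nbhd r Z.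

Definition deep_component Z C := is_component (~` Z) C /\ ~ shallow Z C.

Definition noncrossing {A : Type} (act : A -> X -> X) Y :=
  exists2 k, 0 < k & forall a b : A, act a @` Y <> act b @` Y ->
    exists2 C, deep_component (act b @` Y) C & act a @` Y `<=` unif_nbhd k C.

End Metric.

(* Stated for arbitrary distance functions, as it is used both for metric
   spaces and for word metrics. *)
Definition quasi_isometry {R : realType} {X Y : Type}
    (dX : X -> X -> R) (dY : Y -> Y -> R) (f : X -> Y) :=
  exists L C : R, [/\ 1 <= L, 0 <= C,
    forall x y, L^-1 * dX x y - C <= dY (f x) (f y) <= L * dX x y + C &
    forall z, exists x, dY z (f x) <= C].

Section Subgroup.
Context {G : groupType}.
Implicit Types (H K S : set G).

Definition subgroup H := group_closed [in H].

Definition generated S : set G := smallest subgroup S.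

Definition generates S H := finite_set S /\ generated S = H.

Definition fin_gen H := exists S, generates S H.

Definition rcoset H (g : G) : set G := [set (h * g)%g | h in H].

Definition infinite_index K H := infinite_set [set rcoset K h | h in H].

(* [g] is a product of [n] elements of [S] and inverses of elements of [S]. *)
Definition is_word S (n : nat) (g : G) :=
  exists w : seq G, [/\ size w = n,
    forall s, s \in w -> S s \/ S (s^-1)%g & g = (\prod_(s <- w) s)%g].

(* Length of the shortest word; meaningful when [g^-1 h] lies in [generated S]. *)
Definition word_dist (R : realType) S (g h : G) : R :=
  inf [set n%:R | n in [set n | is_word S n (g^-1 * h)%g]].

Lemma subgroupP H : subgroup H <->
  [/\ H 1%g, forall x y, H x -> H y -> H (x * y)%g &
      forall x, H x -> H (x^-1)%g].
Proof.
split=> [[H1 HF]|[H1 HM HV]]; last first.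
  split; first by apply/mem_set.
  by move=> x y /set_mem Hx /set_mem Hy; apply/mem_set/HM => //; apply: HV.
have cH : group_closed [in H] by split.
split; first exact/set_mem.
- move=> x y Hx Hy; apply/set_mem.
  by apply: (group_closedM cH); apply/mem_set.
- by move=> x Hx; apply/set_mem/(group_closedV cH)/mem_set.
Qed.

End Subgroup.

(* Finitely generated subgroups are quasi-isometric when they are so for their
   own word metrics. This does not depend on the finite generating sets. *)
Definition qi_subgroups (R : realType) {G G' : groupType}
    (H : set G) (H' : set G') :=
  forall S S', generates S H -> generates S' H' ->
    exists q : H -> H', quasi_isometry
      (fun x y : H => word_dist R S (val x) (val y))
      (fun x y : H' => word_dist R S' (val x) (val y)) q.

Record fgGroup := FGGroup {
  fg_sort :> groupType;
  gens : set fg_sort;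
  gensP : generates gens [set: fg_sort] }.

(* The edge joining [g] and [h] is the segment between the vertices [g] and [h]
   in the free real vector space on the vertices; its points are
   [(1 - t) g + t h] for [0 <= t <= 1]. There are no multiple edges, and
   a generator equal to [1] contributes no loop. *)

Section Cayley.
Variables (R : realType) (G : fgGroup).
Implicit Types (g h v : G) (p q : G -> R) (l s t : R).

Definition adjacent g h :=
  exists2 x : G, gens x \/ gens (x^-1)%g & h = (g * x)%g.

Definition edge_point g h t : G -> R :=
  fun v => (1 - t) * (v == g)%:R + t * (v == h)%:R.

Definition is_point p :=
  (exists g, p = edge_point g g 0) \/
  (exists g h t, [/\ adjacent g h, 0 <= t <= 1 & p = edge_point g h t]).

Record cayley := Point { coords : G -> R; coordsP : is_point coords }.

(* [edge_path p q l]: there is a path from [p] to [q] of length [l] made of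
   finitely many segments, each contained in an edge. *)
Inductive edge_path p : (G -> R) -> R -> Prop :=
| edge_path_nil : edge_path p p 0
| edge_path_cons g h s t l :
    adjacent g h -> 0 <= s <= 1 -> 0 <= t <= 1 ->
    edge_path p (edge_point g h s) l ->
    edge_path p (edge_point g h t) (l + `|s - t|).

Definition cayley_dist (x y : cayley) : R :=
  inf [set l | edge_path (coords x) (coords y) l].

Lemma edge_point0 g h : edge_point g h 0 = edge_point g g 0.
Proof. by apply/funext => v; rewrite /edge_point !mul0r !addr0. Qed.

Lemma edge_point_swap g h t : edge_point g h t = edge_point h g (1 - t).
Proof.
apply/funext => v; rewrite /edge_point addrC.
by congr (_ * _ + _); rewrite opprB addrC subrK.
Qed.

Lemma edge_point1 g h : edge_point g h 1 = edge_point h h 0.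
Proof. by rewrite edge_point_swap subrr edge_point0. Qed.

Lemma coords_inj : injective coords.
Proof.
by move=> [p pP] [q qP] /= pq; subst q; congr Point; exact: Prop_irrelevance.
Qed.

Lemma edge_path_ge0 p q l : edge_path p q l -> 0 <= l.
Proof. by elim=> // *; rewrite addr_ge0. Qed.

Lemma edge_path_cat p q r l m :
  edge_path p q l -> edge_path q r m -> edge_path p r (l + m).
Proof.
move=> pq; elim=> [|g h s t k gh s01 t01 _ IH]; first by rewrite addr0.
by rewrite addrA; apply: edge_path_cons IH.
Qed.

Lemma edge_path_seg g h s t : adjacent g h -> 0 <= s <= 1 -> 0 <= t <= 1 ->
  edge_path (edge_point g h s) (edge_point g h t) `|s - t|.
Proof.
move=> gh s01 t01; rewrite -[X in edge_path _ _ X]add0r.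
by apply: edge_path_cons => //; exact: edge_path_nil.
Qed.

Lemma edge_path_sym p q l : edge_path p q l -> edge_path q p l.
Proof.
elim=> [|g h s t k gh s01 t01 _ IH]; first exact: edge_path_nil.
by rewrite addrC distrC; apply: edge_path_cat IH; apply: edge_path_seg.
Qed.

Lemma edge_path_coord p q l v : edge_path p q l -> `|p v - q v| <= l.
Proof.
elim=> [|g h s t k gh s01 t01 _ IH]; first by rewrite subrr normr0.
apply: le_trans (ler_distD (edge_point g h s v) _ _) _; rewrite lerD //.
have -> : edge_point g h s v - edge_point g h t v =
    (s - t) * ((v == h)%:R - (v == g)%:R).
  rewrite /edge_point.
  by ring.
rewrite normrM ler_piMr//.
by case: (v == h); case: (v == g);
  rewrite ?subrr ?subr0 ?sub0r ?normrN ?normr0 ?normr1.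
Qed.

Lemma edge_path_vertices g h :
  exists l, edge_path (edge_point g g 0) (edge_point h h 0) l.
Proof.
pose A : set G := [set x | forall g : G, exists l,
  edge_path (edge_point g g 0) (edge_point (g * x)%g (g * x)%g 0) l].
suff gA : generated (@gens G) `<=` A.
  have /gA /(_ g) : generated (@gens G) (g^-1 * h)%g by rewrite (gensP G).2.
  by rewrite mulgA mulgV mul1g.
apply: smallest_sub; last first.
  move=> x gx u; exists `|0 - 1|.
  rewrite -[X in edge_path X _ _](edge_point0 u (u * x)%g).
  rewrite -[X in edge_path _ X _](edge_point1 u (u * x)%g).
  by apply: edge_path_seg; rewrite ?lexx ?ler01//; exists x => //; left.
apply/subgroupP; split.
- by move=> u; exists 0; rewrite mulg1; exact: edge_path_nil.
- move=> x y Ax Ay u; have [l xl] := Ax u; have [m ym] := Ay (u * x)%g.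
  by exists (l + m); rewrite mulgA; exact: edge_path_cat ym.
- move=> x Ax u; have [l xl] := Ax (u * x^-1)%g; exists l.
  by move: xl; rewrite -mulgA mulVg mulg1 => /edge_path_sym.
Qed.

Lemma point_vertex p : is_point p ->
  exists g, exists l, edge_path (edge_point g g 0) p l.
Proof.
case=> [[g ->]|[g [h [t [gh t01 ->]]]]]; exists g.
  by exists 0; exact: edge_path_nil.
exists `|0 - t|; rewrite -[X in edge_path X _ _](edge_point0 g h).
by apply: edge_path_seg; rewrite ?lexx ?ler01.
Qed.

Lemma edge_path_exists (x y : cayley) :
  exists l, edge_path (coords x) (coords y) l.
Proof.
have [g [l xl]] := point_vertex (coordsP x).
have [h [m ym]] := point_vertex (coordsP y).
have [k ghk] := edge_path_vertices g h.
exists (l + k + m).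
exact: edge_path_cat (edge_path_cat (edge_path_sym xl) ghk) ym.
Qed.

Lemma has_inf_edge_path (x y : cayley) :
  has_inf [set l | edge_path (coords x) (coords y) l].
Proof.
split; first exact: edge_path_exists.
by exists 0 => l /edge_path_ge0.
Qed.

Lemma cayley_distxx x : cayley_dist x x = 0.
Proof.
apply/eqP; rewrite eq_le; apply/andP; split.
  apply: ge_inf; last exact: edge_path_nil.
  by exists 0 => l /edge_path_ge0.
by apply: lb_le_inf; [exact: edge_path_exists | move=> l /edge_path_ge0].
Qed.

Lemma cayley_dist_eq0 x y : cayley_dist x y = 0 -> x = y.
Proof.
move=> xy0; apply: coords_inj; apply/funext => v.
apply/eqP; rewrite -subr_eq0 -normr_le0 -xy0.
apply: lb_le_inf; first exact: edge_path_exists.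
by move=> l; exact: edge_path_coord.
Qed.

Lemma cayley_distC x y : cayley_dist x y = cayley_dist y x.
Proof.
by congr inf; apply/seteqP; split=> l /edge_path_sym.
Qed.

Lemma cayley_dist_triangle y x z :
  cayley_dist x z <= cayley_dist x y + cayley_dist y z.
Proof.
apply/ler_addgt0Pl => e e0; have e20 : 0 < e / 2 by rewrite divr_gt0.
have [l xyl le] := inf_adherent e20 (has_inf_edge_path x y).
have [m yzm me] := inf_adherent e20 (has_inf_edge_path y z).
apply: (@le_trans _ _ (l + m)).
  apply: ge_inf; last exact: edge_path_cat xyl yzm.
  by exists 0 => k /edge_path_ge0.
apply: le_trans (lerD (ltW le) (ltW me)) _.
rewrite addrACA -splitr [leRHS]addrC; exact: lexx.
Qed.

HB.instance Definition _ := gen_eqMixin cayley.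
HB.instance Definition _ := gen_choiceMixin cayley.
HB.instance Definition _ := @isMetric.Build R cayley cayley_dist
  cayley_distxx cayley_dist_eq0 cayley_distC cayley_dist_triangle.

Definition vertex (g : G) : cayley :=
  Point (or_introl (ex_intro _ g erefl)).

Lemma adjacentM k g h : adjacent g h -> adjacent (k * g)%g (k * h)%g.
Proof. by move=> [x gx ->]; exists x; rewrite ?mulgA. Qed.

Lemma edge_pointM k g h t :
  (fun v => edge_point g h t (k^-1 * v)%g) = edge_point (k * g)%g (k * h)%g t.
Proof.
have e a v : (k^-1 * v == a)%g = (v == k * a)%g.
  by apply/eqP/eqP => [<-|->]; rewrite mulgA ?mulgV ?mulVg mul1g.
by apply/funext => v; rewrite /edge_point !e.
Qed.

Lemma translate_subproof (k : G) (x : cayley) :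
  is_point (fun v => coords x (k^-1 * v)%g).
Proof.
case: x => p /= [[g ->]|[g [h [t [gh t01 ->]]]]]; rewrite edge_pointM.
  by left; exists (k * g)%g.
by right; exists (k * g)%g, (k * h)%g, t; split => //; exact: adjacentM.
Qed.

(* The left action; it sends [(1 - t) g + t h] to [(1 - t) (k g) + t (k h)],
   see [edge_pointM]. *)
Definition translate (k : G) (x : cayley) : cayley :=
  Point (translate_subproof k x).

Lemma translate1 x : translate 1%g x = x.
Proof. by apply: coords_inj; apply/funext => v /=; rewrite invg1 mul1g. Qed.

Lemma translateM g h x : translate (g * h)%g x = translate g (translate h x).
Proof. by apply: coords_inj; apply/funext => v /=; rewrite invgM mulgA. Qed.

Lemma translate_vertex k g : translate k (vertex g) = vertex (k * g)%g.
Proof. by apply: coords_inj; rewrite /= edge_pointM. Qed.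

End Cayley.

Definition free_family {F : fieldType} {V : lmodType F} {n : nat}
    (v : 'I_n -> V) :=
  forall a : 'I_n -> F, \sum_i a i *: v i = 0 -> forall i, a i = 0.

(* Dimension of a subspace [W], with value [+oo] when it is infinite. *)
Definition dimension (R : realType) {F : fieldType} {V : lmodType F}
    (W : set V) : \bar R :=
  ereal_sup [set (n%:R)%:E | n in
    [set n : nat | exists2 v : 'I_n -> V, (forall i, W (v i)) & free_family v]].

Definition power_set (T : Type) := set T.

HB.instance Definition _ T := gen_eqMixin (power_set T).
HB.instance Definition _ T := gen_choiceMixin (power_set T).

Lemma power_set_addNr T : left_inverse set0 id (@setY T).
Proof. by move=> X; exact: setYK. Qed.

HB.instance Definition _ T := GRing.isZmodule.Build (power_set T)
  (@setYA T) (@setYC T) (@set0Y T) (@power_set_addNr T).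

Section Coends.
Context {G : groupType}.
Variable H : set G.

Definition coset_finite (X : set G) :=
  exists2 D : set G, finite_set D & X `<=` \bigcup_(g in D) rcoset H g.

Definition coset_finite_sets : {pred power_set G} :=
  fun X => `[< coset_finite X >].

Lemma coset_finite_zmod_closed : zmod_closed coset_finite_sets.
Proof.
split; first by apply/asboolP; exists set0.
move=> X Y /asboolP[D fD XD] /asboolP[E fE YE]; apply/asboolP.
exists (D `|` E); first by rewrite finite_setU.
rewrite bigcup_setU => x [[/XD ? _]|[/YE ? _]]; [by left|by right].
Qed.

HB.instance Definition _ :=
  GRing.isZmodClosed.Build (power_set G) coset_finite_sets
    coset_finite_zmod_closed.

Definition coend_space := Quotient.quot coset_finite_sets.

HB.instance Definition _ := GRing.Zmodule.on coend_space.
HB.instance Definition _ := EqQuotient.on coend_space.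

Definition coend_scale (a : 'F_2) (x : coend_space) : coend_space := x *+ a.

Lemma coend_addxx (x : coend_space) : x + x = 0.
Proof.
elim/quotW: x => X; rewrite -[X in X = _]pi_addr.
have -> : X + X = 0 :> power_set G by exact: setYK.
by rewrite pi_zeror.
Qed.

Lemma coend_mulrn_mod2 (x : coend_space) n : x *+ (n %% 2) = x *+ n.
Proof.
rewrite {2}(divn_eq n 2) mulrnDr mulnC mulrnA mulr2n coend_addxx mul0rn.
by rewrite add0r.
Qed.

Lemma coend_scaleA a b x :
  coend_scale a (coend_scale b x) = coend_scale (a * b) x.
Proof.
rewrite /coend_scale -mulrnA mulnC.
by rewrite [RHS](coend_mulrn_mod2 x (a * b)%N).
Qed.

Lemma coend_scale1 : left_id 1 coend_scale.
Proof. by move=> x; rewrite /coend_scale mulr1n. Qed.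

Lemma coend_scaleDr : right_distributive coend_scale +%R.
Proof. by move=> a x y; rewrite /coend_scale mulrnDl. Qed.

Lemma coend_scaleDl x : {morph coend_scale^~ x : a b / a + b}.
Proof.
move=> a b; rewrite /coend_scale -mulrnDr.
by rewrite [LHS](coend_mulrn_mod2 x (a + b)%N).
Qed.

HB.instance Definition _ := GRing.Zmodule_isLmodule.Build 'F_2 coend_space
  coend_scaleA coend_scale1 coend_scaleDr coend_scaleDl.

Definition coend_class (X : set G) : coend_space := \pi_coend_space (X : power_set G).

Lemma coend_classP X Y :
  coend_class X = coend_class Y <-> coset_finite (X `+` Y).
Proof.
rewrite /coend_class; split.
  by move/eqP; rewrite -Quotient.idealrBE => /asboolP.
by move=> XY; apply/eqP; rewrite -Quotient.idealrBE; apply/asboolP.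
Qed.

(* The subspace fixed by the right action of [G], where
   [rcoset X g] is the translate [X g]. *)
Definition coend_fixed : set coend_space :=
  [set coend_class X | X in
    [set X | forall g, coset_finite (X `+` rcoset X g)]].

End Coends.

Definition num_coends (R : realType) {G : groupType} (H : set G) : \bar R :=
  dimension R (@coend_fixed G H).

(* Main.v *)
Require Import Defs.
From HB Require Import structures.
From mathcomp Require Import all_boot all_order all_algebra.
From mathcomp Require Import all_classical all_reals all_analysis.
From mathcomp Require Import lra.

Set Implicit Arguments.
Unset Strict Implicit.
Unset Printing Implicit Defensive.

Import Order.TTheory GRing.Theory Num.Theory.
Import numFieldNormedType.Exports.

Local Open Scope classical_set_scope.
Local Open Scope ring_scope.

(* Write A for (the vertices near) f(H), Y for a large neighbourhood of A, and
   take a colour c in {0, 1, 2} on G, invariant up to H-finite sets, whose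
   colour classes are not H-finite: it exists since H has three coends, and
   it is transported to G', where it is locally constant far from A. If a
   component of the complement of a neighbourhood of H had a stabilizer K of
   infinite index in H, without being close to H, it would give a second
   K-coend. Hence every component that is not close to H comes uniformly
   close to every point of H. So from every point far from A one can travel,
   far from A, to a bounded neighbourhood of any given point of A. Suppose
   that a point q of a translate aY is far from another translate bY. By the
   noncrossing condition bY lies near one component of the complement of aY,
   so pieces of two of the three colours of aY avoid bY; they both come near
   q, hence lie in one component of the complement of bY. H' is the group of
   those g such that gA is at finite distance from A and g preserves the
   colours far from A. For g in H', the two pieces above have different
   colours with respect to Y, so gA is uniformly close to A and H' lies in a
   neighbourhood of A. Conversely the colours seen in a large ball around
   points h1, h2 of A form finitely many patterns, and if the patterns at h1
   and h2 agree then, by the same dichotomy, h1 h2^-1 is in H'; so A lies in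
   a neighbourhood of H'. *)

(** * Chains in metric spaces *)

Section Linked.
Context {R : realType} {T : Type}.
Variables (d : T -> T -> R) (dC : forall x y, d x y = d y x).
Implicit Types (P Q : set T) (x y z : T) (e : R).

(** Chains with bounded steps replace paths because, unlike connected components, they are carried
    along by quasi-isometries. *)
Inductive linked P e x : T -> Prop :=
| linked_refl : P x -> linked P e x x
| linked_step y z : linked P e x y -> P z -> d y z <= e -> linked P e x z.

Lemma linked_left P e x y : linked P e x y -> P x.
Proof. by elim. Qed.

Lemma linked_right P e x y : linked P e x y -> P y.
Proof. by case. Qed.

Lemma linked_trans P e x y z :
  linked P e x y -> linked P e y z -> linked P e x z.
Proof. by move=> xy; elim=> // u v _ xu Pv; exact: linked_step. Qed.

Lemma linked1 P e x y : P x -> P y -> d x y <= e -> linked P e x y.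
Proof. by move=> Px; apply: linked_step; exact: linked_refl. Qed.

Lemma linked_sym P e x y : linked P e x y -> linked P e y x.
Proof.
elim=> [Px|u v xu ux Pv uv]; first exact: linked_refl.
by apply: linked_trans ux; apply: linked1 => //;
  [exact: linked_right xu|rewrite dC].
Qed.

Lemma linked_subset P Q e x y : P `<=` Q -> linked P e x y -> linked Q e x y.
Proof.
move=> PQ; elim=> [Px|u v _ xu Pv uv]; first by apply/linked_refl/PQ.
by apply: linked_step xu _ uv; exact: PQ.
Qed.

Lemma linked_ind_const (U : Type) (c : T -> U) P e x y :
  (forall u v, P u -> P v -> d u v <= e -> c u = c v) ->
  linked P e x y -> c x = c y.
Proof.
move=> cE; elim=> // u v xu -> Pv uv.
by apply: cE => //; exact: linked_right xu.
Qed.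

Definition far (A : set T) e : set T := [set x | forall a, A a -> e < d x a].

Lemma farN A e x : ~ far A e x -> exists2 a, A a & d x a <= e.
Proof.
move=> xA; apply: contrapT => nA; apply: xA => a Aa.
by rewrite ltNge; apply/negP => xa; apply: nA; exists a.
Qed.

Lemma far_le A e e' x : e' <= e -> far A e x -> far A e' x.
Proof. by move=> ee xA a /xA; exact: le_lt_trans. Qed.

End Linked.

Lemma linked_map (R : realType) (T U : Type) (d : T -> T -> R) (d' : U ->
  U -> R)
    (f : T -> U) (P : set T) (Q : set U) e e' x y :
  (forall z, P z -> Q (f z)) -> (forall u v, d u v <= e ->
    d' (f u) (f v) <= e') ->
  linked d P e x y -> linked d' Q e' (f x) (f y).
Proof.
move=> PQ ee; elim=> [Px|u v _ xu Pv uv]; first by apply/linked_refl/PQ.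
by apply: linked_step xu _ _; [exact: PQ|exact: ee].
Qed.

Lemma finite_set_bounded (R : realType) (T : Type) (A : set T) (F : T -> R) :
  finite_set A -> exists M, forall x, A x -> F x <= M.
Proof.
move=> fA; have : finite_set (F @` A) by exact: finite_image.
move=> /finite_seqP[s sE]; exists (\sum_(y <- s) `|y|) => x Ax.
have : F x \in s by have : [set` s] (F x) by rewrite -sE; exists x.
elim: s {sE} => // y s IH; rewrite in_cons big_cons => /orP[/eqP <-|/IH sx].
  by rewrite (le_trans (ler_norm _))// lerDl sumr_ge0.
by rewrite (le_trans sx)// lerDr.
Qed.

Section MetricSpace.
Context {R : realType} {X : metricType R}.
Implicit Types (Y Z C : set X) (r e : R) (x y z : X).

(** The points reached by an [e]-chain are relatively clopen in [C]: in a ball of radius [e], all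
    points of [C] are reached if the centre is, and none if it is an unreached point of [C]. *)
Lemma connected_linked C e x y :
  0 < e -> connected C -> C x -> C y -> linked (@mdist R X) C e x y.
Proof.
move=> e0 cC Cx Cy.
pose B := [set z | linked (@mdist R X) C e x z].
suff : B = C by move=> BC; have : B y by rewrite BC.
have ballsub z w : ball z e w -> mdist z w <= e.
  by rewrite ballEmdist /= => /ltW.
apply: cC.
- by exists x; exact: linked_refl.
- exists (\bigcup_(z in B) (ball z e)°).
    by apply: bigcup_open => z _; exact: open_interior.
  apply/seteqP; split => [z Bz|z [Cz [w Bw /interior_subset/ballsub wz]]].
    split; first exact: linked_right Bz.
    by exists z => //; apply: nbhsx_ballx.
  exact: linked_step Bw Cz wz.
- exists (~` \bigcup_(z in C `\` B) (ball z e)°).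
    by apply/open_closedC/bigcup_open => z _; exact: open_interior.
  apply/seteqP; split => [z Bz|z [Cz nz]].
    split; first exact: linked_right Bz.
    move=> [w [Cw nBw] /interior_subset/ballsub wz]; apply: nBw.
    by apply: linked_step Bz Cw _; rewrite metric_sym.
  apply: contrapT => nBz; apply: nz; exists z => //.
  by apply: nbhsx_ballx.
Qed.

Lemma unif_nbhd_in Y r x y : Y y -> mdist x y <= r -> unif_nbhd r Y x.
Proof.
move=> Yy xy; apply: (@le_trans _ _ (mdist x y)%:E); last by rewrite lee_fin.
by apply: ereal_inf_lbound; exists y.
Qed.

(** The infimum need not be attained, hence the slack [e]. *)
Lemma unif_nbhdP Y r e x : 0 < e -> unif_nbhd r Y x ->
  exists2 y, Y y & mdist x y < r + e.
Proof.
move=> e0 xY; have : (dist_to x Y < (r + e)%:E)%E.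
  by apply: le_lt_trans xY _; rewrite lte_fin ltrDl.
by move=> /ereal_inf_lt[_ [y Yy <-]]; rewrite lte_fin; exists y.
Qed.

Lemma unif_nbhdN Y r x y : ~ unif_nbhd r Y x -> Y y -> r < mdist x y.
Proof.
by move=> nY Yy; rewrite ltNge; apply/negP => /(unif_nbhd_in Yy).
Qed.

End MetricSpace.

(** * Distances between vertices of a Cayley graph *)

Section Words.
Context {G : groupType}.
Implicit Types (S : set G) (g h x : G) (m n : nat).

Lemma is_word0 S : is_word S 0 1%g.
Proof. by exists [::]; split => //; rewrite big_nil. Qed.

Lemma is_word1 S x : S x \/ S (x^-1)%g -> is_word S 1 x.
Proof.
move=> Sx; exists [:: x]; split => //; last by rewrite big_seq1.
by move=> s; rewrite mem_seq1 => /eqP ->.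
Qed.

Lemma is_wordM S m n g h :
  is_word S m g -> is_word S n h -> is_word S (m + n) (g * h)%g.
Proof.
move=> [v [<- vS ->]] [w [<- wS ->]]; exists (v ++ w).
split; [by rewrite size_cat| |by rewrite big_cat].
by move=> s; rewrite mem_cat => /orP[/vS|/wS].
Qed.

Lemma is_word_ind S (P : G -> Prop) : P 1%g ->
  (forall g x : G, P g -> S x \/ S (x^-1)%g -> P (g * x)%g) ->
  forall n g, is_word S n g -> P g.
Proof.
move=> P1 PM n g [w [_ + ->]] {g n}; elim/last_ind: w => [|w x IH] wS.
  by rewrite big_nil.
rewrite -cats1 big_cat big_seq1; apply: PM; last first.
  by apply: wS; rewrite mem_rcons mem_head.
by apply: IH => s sw; apply: wS; rewrite mem_rcons in_cons sw orbT.
Qed.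

Lemma is_word_splitl S n g : is_word S n.+1 g ->
  exists x h, [/\ S x \/ S (x^-1)%g, is_word S n h & g = (x * h)%g].
Proof.
move=> [[|x w] [] // [sw] wS ->]; exists x, (\prod_(s <- w) s)%g.
split; [by apply: wS; rewrite mem_head| |by rewrite big_cons].
by exists w; split => // s sw'; apply: wS; rewrite in_cons sw' orbT.
Qed.

Lemma finite_is_word S n : finite_set S -> finite_set [set g | is_word S n g].
Proof.
move=> fS; elim: n => [|n IH].
  apply: (sub_finite_set _ (finite_set1 1%g)) => g [w [/size0nil -> _ ->]].
  by rewrite /= big_nil.
have fSV : finite_set (S `|` [set (x^-1)%g | x in S]).
  by rewrite finite_setU; split => //; exact: finite_image.
apply: (sub_finite_set _ (finite_image2 ( *%g) fSV IH)) => g.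
move=> /is_word_splitl[x [h [Sx hn ->]]]; exists x; last by exists h.
by case: Sx => [|Sx]; [left|right; exists (x^-1)%g; rewrite ?invgK].
Qed.

Lemma generatedP S g : generated S g <-> exists n, is_word S n g.
Proof.
split=> [gS|[n]].
  suff /(_ _ gS) : generated S `<=` [set g | exists n, is_word S n g] by [].
  apply: smallest_sub => [|x Sx]; last by exists 1%N; apply: is_word1; left.
  apply/subgroupP; split=> [|x y [m xm] [n yn]|x [n]].
  - by exists 0%N; exact: is_word0.
  - by exists (m + n)%N; exact: is_wordM.
  - move: x; elim: n => [|n IH] x.
      move=> [w [/size0nil -> _ ->]]; rewrite big_nil invg1.
      by exists 0%N; exact: is_word0.
    move=> /is_word_splitl[y [h [Sy /IH[m hm] ->]]]; exists (m + 1)%N.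
    rewrite invgM; apply: is_wordM => //; apply: is_word1.
    by rewrite invgK; case: Sy; [right|left].
move=> gn K [/subgroupP[K1 KM KV] SK].
move: n g gn; apply: is_word_ind => // g x Kg [/SK Kx|/SK /KV]; first exact: KM.
by rewrite invgK; exact: KM.
Qed.

End Words.

Section CayleyGeometry.
Variables (R : realType) (G : fgGroup).
Implicit Types (g h u v w : G) (x y z : cayley R G) (l r s t : R).

Lemma edge_path_translate k (p q : G -> R) l : edge_path p q l ->
  edge_path (fun v => p (k^-1 * v)%g) (fun v => q (k^-1 * v)%g) l.
Proof.
elim=> [|g h s t m gh s01 t01 _]; first exact: edge_path_nil.
rewrite !edge_pointM => IH; apply: edge_path_cons => //; exact: adjacentM.
Qed.

Lemma mdist_translate_le k x y :
  mdist (translate k x) (translate k y) <= mdist x y.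
Proof.
apply: lb_le_inf; first exact: edge_path_exists.
move=> l /(edge_path_translate k) xyl; apply: ge_inf => //.
by exists 0 => m /edge_path_ge0.
Qed.

Lemma translateVK k : cancel (@translate R G k^-1) (translate k).
Proof. by move=> x; rewrite -translateM mulgV translate1. Qed.

Lemma translateKV k : cancel (@translate R G k) (translate k^-1).
Proof. by move=> x; rewrite -translateM mulVg translate1. Qed.

Lemma mdist_translate k x y : mdist (translate k x) (translate k y) = mdist x y.
Proof.
apply/eqP; rewrite eq_le mdist_translate_le /=.
by rewrite -{1}(translateKV k x) -{1}(translateKV k y) mdist_translate_le.
Qed.

Definition vd g h : R := mdist (vertex R g) (vertex R h).

Lemma vdE g h : vd g h = mdist (vertex R g) (vertex R h). Proof. by []. Qed.

Lemma vdxx g : vd g g = 0. Proof. exact: mdistxx. Qed.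

Lemma vdC g h : vd g h = vd h g. Proof. exact: metric_sym. Qed.

Lemma vd_triangle u v w : vd u w <= vd u v + vd v w.
Proof. exact: metric_triangle. Qed.

Lemma vdM k g h : vd (k * g)%g (k * h)%g = vd g h.
Proof. by rewrite /vd -!translate_vertex mdist_translate. Qed.

Lemma edge_path_mdist x y l : edge_path (coords x) (coords y) l ->
  mdist x y <= l.
Proof. by move=> xyl; apply: ge_inf => //; exists 0 => m /edge_path_ge0. Qed.

Lemma vd_adjacent g h : Defs.adjacent g h -> vd g h <= 1.
Proof.
move=> gh; apply: (@le_trans _ _ `|0 - 1|); last by rewrite sub0r normrN1.
apply: edge_path_mdist; rewrite /= -(edge_point1 R g h) -(edge_point0 R g h).
by apply: edge_path_seg => //; rewrite ?lexx ?ler01.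
Qed.

Lemma adjacentP g (x : G) : gens x \/ gens (x^-1)%g ->
  Defs.adjacent g (g * x)%g.
Proof. by move=> gx; exists x. Qed.

Lemma word_exists g : exists n, is_word (@gens G) n g.
Proof. by apply/generatedP; rewrite (gensP G).2. Qed.

(* At [p = (1 - t) g + t h] this says that [g] has word distance at most [l + t]
   from [u], and [h] at most [l + 1 - t]. *)
Lemma edge_path_word u p l : edge_path (@edge_point R G u u 0) p l ->
  forall v, 0 < p v -> exists2 n,
    is_word (@gens G) n (u^-1 * v)%g & n%:R <= l + 1 - p v.
Proof.
elim=> [|g h s t m gh s01 t01 _ IH] v.
  rewrite /edge_point mul0r addr0 subr0 mul1r.
  case: eqP => [-> _|_]; last by rewrite ltxx.
  by exists 0%N; [rewrite mulVg; exact: is_word0|rewrite /=; lra].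
have [gh'|ngh] := eqVneq g h.
  subst h; have e r : @edge_point R G g g r v = (v == g)%:R.
    by rewrite /edge_point -mulrDl subrK mul1r.
  rewrite e => vg; have [|n wn nm] := IH v; first by rewrite e.
  by exists n => //; rewrite e in nm; have := normr_ge0 (s - t); lra.
have [x gx hE] := gh.
have hg : h != g by rewrite eq_sym.
have ge r : @edge_point R G g h r g = 1 - r.
  by rewrite /edge_point eqxx (negbTE ngh) mulr0 addr0 mulr1.
have he r : @edge_point R G g h r h = r.
  by rewrite /edge_point eqxx (negbTE hg) mulr0 add0r mulr1.
have [n1 n2] : (s - t <= `|s - t|) /\ (t - s <= `|s - t|).
  by split; [exact: ler_norm|rewrite distrC; exact: ler_norm].
(* For [0 < s < 1] both bounds come from the induction hypothesis; at an end of the edge only one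
   does, and the other costs one more letter. *)
have {IH} [wg wh] : (exists2 n,
  is_word (@gens G) n (u^-1 * g)%g & n%:R <= m + s) /\
   (exists2 n, is_word (@gens G) n (u^-1 * h)%g & n%:R <= m + 1 - s).
  have [s0|s0] := ltP 0 s; last first.
    have s0' : s = 0 by lra.
    have [|n wn nm] := IH g; first by rewrite ge; lra.
    rewrite ge in nm; split; first by exists n => //; lra.
    exists (n + 1)%N; last by rewrite natrD; lra.
    by rewrite hE mulgA; apply: is_wordM => //; exact: is_word1.
  have [|n wn nm] := IH h; first by rewrite he.
  rewrite he in nm; split; last by exists n.
  have [s1|s1] := ltP s 1; last first.
    exists (n + 1)%N; last by rewrite natrD; lra.
    have -> : (u^-1 * g = u^-1 * h * x^-1)%g by rewrite hE mulgA mulgK.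
    by apply: is_wordM => //; apply: is_word1; rewrite invgK; case: gx;
      [right|left].
  have [|k wk km] := IH g; first by rewrite ge; lra.
  by exists k => //; rewrite ge in km; lra.
have [->|vg] := eqVneq v g.
  by rewrite ge => _; have [n wn nm] := wg; exists n => //; lra.
have [->|vh] := eqVneq v h.
  by rewrite he => _; have [n wn nm] := wh; exists n => //; lra.
by rewrite /edge_point (negbTE vg) (negbTE vh) !mulr0 addr0 ltxx.
Qed.

(** At a vertex the coordinate is 1, so [edge_path_word] gives a word no longer than the path. *)
Lemma vd_word u v r : vd u v < r ->
  exists2 n, is_word (@gens G) n (u^-1 * v)%g & n%:R < r.
Proof.
move=> uvr; have e0 : 0 < r - vd u v by rewrite subr_gt0.
have [l] := inf_adherent e0 (has_inf_edge_path (vertex R u) (vertex R v)).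
rewrite -[inf _]/(vd u v) addrC subrK => /= uvl lr.
have ve : @edge_point R G v v 0 v = 1.
  by rewrite /edge_point eqxx mul0r addr0 subr0 mulr1.
have [|n wn nl] := edge_path_word uvl (v := v); first by rewrite ve.
by exists n => //; rewrite ve in nl; lra.
Qed.

(** Local finiteness turns bounds on distances into finite unions of cosets and finite sets of
    colour patterns. *)
Lemma finite_vd_ball r : finite_set [set g | vd 1%g g <= r].
Proof.
apply: (@sub_finite_set _ _
  (\bigcup_(n in [set n | (n < (Num.truncn (r + 1)).+1)%N]) [set g | is_word
    (@gens G) n g])).
  move=> g /= gr; have [|n] := @vd_word 1%g g (r + 1); first by lra.
  rewrite invg1 mul1g => wn nr; exists n => //=.
  rewrite -(ltr_nat R); apply: lt_trans nr _; exact: truncnS_gt.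
apply: bigcup_finite; first exact: finite_II.
by move=> n _; apply: finite_is_word; exact: (gensP G).1.
Qed.

Lemma vd_linked u v : linked vd setT 1 u v.
Proof.
have [n] := word_exists (u^-1 * v).
suff H g : is_word (@gens G) n g -> linked vd setT 1 u (u * g)%g.
  by move=> /H; rewrite mulVKg.
move: n g; apply: is_word_ind; first by rewrite mulg1; exact: linked_refl.
move=> g x ug gx; apply: linked_step ug _ _ => //.
by rewrite mulgA; apply/vd_adjacent/adjacentP.
Qed.

Lemma near_vertex x : exists g, mdist x (vertex R g) <= 1.
Proof.
have [[g xg]|[g [h [t [gh t01 xg]]]]] := coordsP x.
  exists g; have -> : x = vertex R g by exact: coords_inj.
  by rewrite mdistxx.
exists g; apply: (@le_trans _ _ `|t - 0|); last by rewrite subr0 ger0_norm; lra.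
apply: edge_path_mdist; rewrite xg /= -(edge_point0 R g h).
by apply: edge_path_seg => //; lra.
Qed.

End CayleyGeometry.

(** * Connected subsets of a Cayley graph *)

Section CayleyTopology.
Variables (R : realType) (G : fgGroup).
Implicit Types (g h u v w : G) (x y z : cayley R G) (l r s t : R).

(** Makes the parametrization of an edge total on the real line, and still 1-Lipschitz. *)
Definition clamp t : R := Num.max 0 (Num.min 1 t).

Lemma clamp_itv t : 0 <= clamp t <= 1.
Proof. by rewrite /clamp le_max lexx ge_max ler01 ge_min lexx. Qed.

Lemma clampK t : 0 <= t <= 1 -> clamp t = t.
Proof. by move=> /andP[t0 t1]; rewrite /clamp (min_idPr t1) (max_idPr t0). Qed.

Lemma clamp_dist s t : `|clamp s - clamp t| <= `|s - t|.
Proof.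
have := ler_norm (s - t); have := ler_norm (t - s);
  rewrite distrC ler_norml /clamp.
case: (leP 1 s) => ?; case: (leP 1 t) => ?; case: (leP 0 s) => ?;
  case: (leP 0 t) => ?; case: (leP 0 (1 : R)) => ?; lra.
Qed.

Lemma edge_is_point g h t : Defs.adjacent g h ->
  is_point (@edge_point R G g h (clamp t)).
Proof. by move=> gh; right; exists g, h, (clamp t); rewrite clamp_itv. Qed.

Definition edge_map g h (gh : Defs.adjacent g h) t : cayley R G :=
  Point (edge_is_point t gh).

Lemma edge_map_dist g h (gh : Defs.adjacent g h) s t :
  mdist (edge_map gh s) (edge_map gh t) <= `|s - t|.
Proof.
apply: le_trans (clamp_dist s t); apply: edge_path_mdist => /=.
by apply: edge_path_seg; rewrite ?clamp_itv.
Qed.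

Lemma edge_map_continuous g h (gh : Defs.adjacent g h) :
  continuous (edge_map gh).
Proof.
move=> t; apply/(@metricType_numDomainType.cvgrPdist_lt _ (cayley R G)) =>
  e e0; near=> s.
apply: le_lt_trans (edge_map_dist gh t s) _.
by near: s; apply: (@cvgr_dist_lt _ _ _ _ _ id t).
Unshelve. all: end_near. Qed.

(** Each segment is the continuous image of an interval and meets the set built so far at its
    initial point. *)
Lemma edge_path_connected x y l : edge_path (coords x) (coords y) l ->
  exists S : set (cayley R G),
    [/\ connected S, S x, S y & forall z, S z -> mdist x z <= l].
Proof.
move: {2}(coords y) (erefl (coords y)) => q qE; rewrite qE => xq.
elim: xq y qE => [|g h s t m gh s01 t01 xm IH] y yE.
  exists [set x]; have -> : y = x by exact: coords_inj.
  by split => // [|z ->]; [exact: connected1|rewrite mdistxx].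
have [|S [cS Sx Sm Sl]] := IH (edge_map gh s); first by rewrite /= clampK.
pose I : set R := [set` `[Num.min s t, Num.max s t]].
have Is : I s by rewrite /I /= in_itv /= ge_min le_max lexx.
have It : I t by rewrite /I /= in_itv /= ge_min le_max lexx !orbT.
have yt : y = edge_map gh t by apply: coords_inj; rewrite yE /= clampK.
exists (S `|` (edge_map gh @` I)); split.
- apply: connectedU => //; first by exists (edge_map gh s); split => //;
    exists s.
  apply: connected_continuous_connected; first exact: segment_connected.
  by apply: continuous_subspaceT; exact: edge_map_continuous.
- by left.
- by right; exists t.
- move=> z [/Sl|[r]]; first by have := normr_ge0 (s - t); lra.
  rewrite /I /= in_itv /= => Ir <-.
  have := Sl _ Sm; have := edge_map_dist gh s r.
  have := metric_triangle x (edge_map gh s) (edge_map gh r).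
  have : `|s - r| <= `|s - t|.
    have := ler_norm (s - t); have := ler_norm (t - s);
      rewrite distrC ler_norml.
    by move: Ir; case: (leP s t); lra.
  lra.
Qed.

(** A path from [x] of length less than [r] is connected and stays in the ball of radius [r]. *)
Lemma cayley_component (Z : set (cayley R G)) x y r :
  mdist x y < r -> (forall z, mdist x z < r -> Z z) ->
    connected_component Z x y.
Proof.
move=> xyr xZ; have e0 : 0 < r - mdist x y by rewrite subr_gt0.
have [l] := inf_adherent e0 (has_inf_edge_path x y).
rewrite -[inf _]/(mdist x y) addrC subrK =>
  /= /edge_path_connected[S [cS Sx Sy Sl]] lr.
exists S => //; split => // z /Sl zl; apply: xZ; exact: le_lt_trans lr.
Qed.

End CayleyTopology.

(** * Coends *)

Section CosetFinite.
Context {G : groupType}.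
Implicit Types (H K X Y : set G) (g h x : G).

Lemma rcosetP X g x : rcoset X g x <-> X (x * g^-1)%g.
Proof.
split=> [[y Xy <-]|Xx]; first by rewrite mulgK.
by exists (x * g^-1)%g => //; rewrite mulgVK.
Qed.

Lemma coset_finite_sub K X Y : X `<=` Y -> coset_finite K Y -> coset_finite K X.
Proof. by move=> XY [D fD YD]; exists D => //; exact: subset_trans YD. Qed.

Lemma coset_finiteU K X Y :
  coset_finite K X -> coset_finite K Y -> coset_finite K (X `|` Y).
Proof.
move=> [D fD XD] [E fE YE]; exists (D `|` E); first by rewrite finite_setU.
by rewrite bigcup_setU; exact: setUSS.
Qed.

Lemma coset_finite_bigcup (I : Type) (A : set I) K (F : I -> set G) :
  finite_set A -> (forall i, A i -> coset_finite K (F i)) ->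
  coset_finite K (\bigcup_(i in A) F i).
Proof.
move=> fA cF.
have /choice[D DP] : forall i, exists D : set G,
    A i -> finite_set D /\ F i `<=` \bigcup_(g in D) rcoset K g.
  move=> i; have [/cF[D fD FD]|nA] := pselect (A i); first by exists D.
  by exists set0.
exists (\bigcup_(i in A) D i).
  by apply: bigcup_finite => // i /DP[].
move=> x [i Ai Fx]; have [_ /(_ x Fx)[g Dg xg]] := DP i Ai.
by exists g => //; exists i.
Qed.

Lemma coset_finite_rcoset K X g : coset_finite K X ->
  coset_finite K (rcoset X g).
Proof.
move=> [D fD XD]; exists [set (d * g)%g | d in D]; first exact: finite_image.
move=> _ [x /XD[d Dd [k Kk <-]] <-]; exists (d * g)%g; first by exists d.
by exists k => //; rewrite mulgA.
Qed.

Lemma coend_classD K X Y :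
  coend_class K (X `+` Y) = coend_class K X + coend_class K Y.
Proof. by rewrite /coend_class -[RHS]pi_addr. Qed.

Lemma coend_class0P K X : coend_class K X = 0 <-> coset_finite K X.
Proof.
have -> : 0 = coend_class K set0 by rewrite /coend_class pi_zeror.
by rewrite coend_classP setY0.
Qed.

Lemma coend_scale_bool K X (b : bool) :
  (b%:R : 'F_2) *: coend_class K X = coend_class K (if b then X else set0).
Proof.
case: b; first by rewrite scale1r.
by rewrite scale0r; apply/esym/coend_class0P; exists set0.
Qed.

Lemma F2_bool (a : 'F_2) : a = (a != 0)%:R.
Proof. by case: a => -[|[|[]]] // ?; apply: val_inj. Qed.

(** The classes of [E] and of the whole group are independent: their nonzero combinations are
    represented by [E], its complement and the whole group, none of them [K]-finite. *)
Lemma num_coends_ge2 (R : realType) K E :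
  (forall g, coset_finite K (E `+` rcoset E g)) ->
  ~ coset_finite K E -> ~ coset_finite K (~` E) -> (2%:E <= num_coends R K)%E.
Proof.
move=> inv nE nCE; apply: ereal_sup_ubound; exists 2 => //=.
pose v (i : 'I_2) := coend_class K (if i == ord0 then E else setT).
exists v => [i|a].
  rewrite /v; case: ifP => _; first by exists E.
  exists setT => // g; exists set0 => //.
  by move=> x [[_ nx]|[_ nx]]; case: nx => //; apply/rcosetP.
rewrite big_ord_recl big_ord1 /v eqxx /=.
rewrite (F2_bool (a ord0)) (F2_bool (a (lift _ _))) !coend_scale_bool
  -coend_classD.
move=> /coend_class0P; case: eqVneq => a0; case: eqVneq => a1 /= fE.
- move=> i; have [j ->|->] := unliftP ord0 i; last by rewrite a0.
  by rewrite ord1 a1.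
- by exfalso; apply: nE; rewrite set0Y in fE; exact: coset_finite_sub fE.
- by exfalso; apply: nE; apply: coset_finite_sub fE; rewrite setY0.
- exfalso; apply: nCE; apply: coset_finite_sub fE => x Ex.
  by right; split.
Qed.

Lemma free_family3 (F : fieldType) (V : lmodType F) n (v : 'I_n.+3 -> V) :
  free_family v -> forall a b c : F,
  a *: v (inord 0) + b *: v (inord 1) + c *: v (inord 2) = 0 ->
  [/\ a = 0, b = 0 & c = 0].
Proof.
move=> fv a b c abc.
have inj i j : (i < n.+3)%N -> (j < n.+3)%N ->
  (inord i == inord j :> 'I_n.+3) = (i == j).
  by move=> ? ?; rewrite -val_eqE /= !inordK.
pose e (i : 'I_n.+3) := if i == inord 0 then a else
  if i == inord 1 then b else if i == inord 2 then c else 0.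
have e0 : e (inord 0) = a by rewrite /e eqxx.
have e1 : e (inord 1) = b by rewrite /e !inj.
have e2 : e (inord 2) = c by rewrite /e !inj.
suff e_0 : forall i, e i = 0 by rewrite -e0 -e1 -e2 !e_0.
apply: fv; rewrite (bigD1 (inord 0)) // (bigD1 (inord 1)) /=;
  last by rewrite inj.
rewrite (bigD1 (inord 2)) /=; last by rewrite !inj.
rewrite big1 => [|i /andP[/andP[i0 i1] i2]]; last first.
  by rewrite /e (negbTE i0) (negbTE i1) (negbTE i2) scale0r.
by rewrite addr0 addrA e0 e1 e2.
Qed.

Lemma three_coends (R : realType) H : (3%:E <= num_coends R H)%E ->
  exists X1 X2 X3 : set G,
    (forall X, [\/ X = X1, X = X2 | X = X3] ->
       forall g, coset_finite H (X `+` rcoset X g)) /\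
    (forall a b c : bool, a || b || c -> ~ coset_finite H
      ((if a then X1 else set0) `+` (if b then X2 else set0)
         `+` (if c then X3 else set0))).
Proof.
(* The dimension is a supremum over the sizes of free families; if all sizes were below 3, it would
   be at most 2. *)
move=> H3; have [n [n3 [v vH fv]]] : exists n : nat, (3 <= n)%N /\
    exists2 v : 'I_n -> coend_space H, (forall i,
      coend_fixed (v i)) & free_family v.
  apply: contrapT => nH; suff : (num_coends R H <= 2%:E)%E.
    by move=> /(le_trans H3); rewrite lee_fin; lra.
  apply: ge_ereal_sup => _ [n [v vH fv] <-]; rewrite lee_fin ler_nat leqNgt.
  by apply/negP => n3; apply: nH; exists n; split => //; exists v.
case: n n3 v vH fv => [|[|[|n]]] // _ v vH fv.
have [X1 X1i X1v] := vH (inord 0).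
have [X2 X2i X2v] := vH (inord 1).
have [X3 X3i X3v] := vH (inord 2).
exists X1, X2, X3; split=> [X [] -> //|a b c abc].
move=> /coend_class0P; rewrite !coend_classD -!coend_scale_bool X1v X2v X3v.
move=> /(free_family3 fv)[].
by case: a b c abc => -[] [].
Qed.

End CosetFinite.

(** * Coends and the complement of a neighbourhood of a subgroup *)

Section Coends.
Variables (R : realType) (G : fgGroup).
Implicit Types (H K X : set G) (g h u v x : G) (r s t : R).
Local Notation vd := (@vd R G).
Local Notation far := (far vd).
Local Notation linked := (linked vd).

Lemma vdVl g u v : vd (g^-1 * u)%g v = vd u (g * v)%g.
Proof. by rewrite -(vdM R g) mulVKg. Qed.

Lemma vd1V u v : vd 1%g (u^-1 * v)%g = vd u v.
Proof. by rewrite vdC vdVl mulg1 vdC. Qed.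

(** By left invariance [H g] lies within the length of [g] from [H]. With the converse below, the
    [H]-finite sets are those in a bounded neighbourhood of [H]. *)
Lemma coset_finite_bounded H X : coset_finite H X ->
  exists r, forall x, X x -> ~ far H r x.
Proof.
move=> [D fD XD]; have [r rP] := finite_set_bounded (vd 1%g) fD.
exists r => x /XD[g Dg [h Hh <-]] /(_ h Hh).
by rewrite vdC -{1}(mulg1 h) vdM ltNge rP.
Qed.

Lemma bounded_coset_finite H X r :
  (forall x, X x -> ~ far H r x) -> coset_finite H X.
Proof.
move=> Xr; exists [set g | vd 1%g g <= r]; first exact: finite_vd_ball.
move=> x /Xr nx; have [h Hh xh] := farN nx.
exists (h^-1 * x)%g; first by rewrite /= vd1V vdC.
by exists h => //; rewrite mulVKg.
Qed.

Lemma far_subgroupM H h r x : subgroup H -> H h -> far H r x ->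
  far H r (h * x)%g.
Proof.
move=> /subgroupP[_ HM HV] Hh xr a Ha; rewrite -(mulVKg h a) vdM.
by apply: xr; apply: HM => //; exact: HV.
Qed.

Lemma linked_subgroupM H h r x y : subgroup H -> H h ->
  linked (far H r) 1 x y -> linked (far H r) 1 (h * x)%g (h * y)%g.
Proof.
move=> sH Hh; apply: linked_map => [z|u v]; first exact: far_subgroupM.
by rewrite vdM.
Qed.

Lemma linked_exit (P : set G) r u v : linked setT r u v -> P u ->
  linked P r u v \/ exists x y, [/\ linked P r u x, ~ P y & vd x y <= r].
Proof.
move=> uv Pu; elim: v / uv => [_|x y _ [ux|ex] _ xy]; first by left;
  exact: linked_refl.
  have [Py|nPy] := pselect (P y); first by left; exact: linked_step Py xy.
  by right; exists x, y.
by right.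
Qed.

(* The colours are atoms of the Boolean algebra generated by three independent
   classes: for any two atoms [a], [a'] some nonzero [b] is orthogonal to both,
   and as the combination of the classes given by [b] is not H-finite, neither
   is some atom that is not orthogonal to [b]. *)
Lemma three_colouring H : (3%:E <= num_coends R H)%E ->
  exists c : G -> 'I_3,
    (forall r, exists t, forall u v, vd u v <= r -> far H t u -> c u = c v) /\
    (forall i t, exists2 v, far H t v & c v = i).
Proof.
move=> /three_coends[X1 [X2 [X3 [Xinv Xfree]]]].
pose bit (X : set G) g : bool := `[< X g >].
have bitY X Y g : bit (X `+` Y) g = bit X g (+) bit Y g.
  rewrite /bit; apply/asboolP/idP => [[[Xg Yg]|[Yg Xg]]|].
  - by rewrite (asboolT Xg) (asboolF Yg).
  - by rewrite (asboolT Yg) (asboolF Xg).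
  - by case: asboolP => Xg; case: asboolP => Yg // _; [left|right].
have bit_if (b : bool) X g : bit (if b then X else set0) g = b && bit X g.
  by case: b => //; apply/asboolP.
pose atom g : bool * bool * bool := (bit X1 g, bit X2 g, bit X3 g).
pose dot (b a : bool * bool * bool) :=
  (b.1.1 && a.1.1) (+) (b.1.2 && a.1.2) (+) (b.2 && a.2).
have big b : b != (false, false, false) ->
    exists a, dot b a /\ ~ coset_finite H [set g | atom g = a].
  move=> b0; apply: contrapT => nb.
  apply: (Xfree b.1.1 b.1.2 b.2); first by case: b b0 {nb} => -[[] []] [].
  apply: (@coset_finite_sub _ _ _ (\bigcup_(a in [set a | dot b a])
    [set g | atom g = a])); last first.
    apply: coset_finite_bigcup => // a ba.
    by apply: contrapT => na; apply: nb; exists a.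
  move=> g /asboolP bg; exists (atom g) => //.
  by move: bg; rewrite -/(bit _ g) !bitY !bit_if.
(* Two linear conditions on a three-dimensional space over the two-element field leave a nonzero
   solution; the seven nonzero vectors are tried. *)
have ker a a' : exists2 b, b != (false, false,
  false) & ~~ dot b a && ~~ dot b a'.
  case: a => -[[] []] []; case: a' => -[[] []] [];
  first [by exists (true, false, false) | by exists (false, true, false)
  | by exists (false, false, true) | by exists (true, true, false)
  | by exists (true, false, true) | by exists (false, true, true)
  | by exists (true, true, true)].
have [a1 [_ N1]] := big (true, false, false) isT.
have [b2 /big[a2 [d2 N2]] /andP[d21 _]] := ker a1 a1.
have [b3 /big[a3 [d3 N3]] /andP[d31 d32]] := ker a1 a2.
have n21 : a2 != a1 by apply: contraNneq d21 => <-.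
have n31 : a3 != a1 by apply: contraNneq d31 => <-.
have n32 : a3 != a2 by apply: contraNneq d32 => <-.
(* The last colour collects all remaining atoms, [a3] among them. *)
pose c g : 'I_3 := if atom g == a1 then inord 0 else
  if atom g == a2 then inord 1 else inord 2.
exists c; split=> [r|i t]; last first.
  have far_atom a : ~ coset_finite H [set g | atom g = a] ->
      exists2 v, far H t v & atom v = a.
    move=> na; apply: contrapT => nv; apply: na.
    apply: (@bounded_coset_finite _ _ t) => x xa xt.
    by apply: nv; exists x.
  have i3 : i = inord i by apply: val_inj; rewrite /= inordK.
  have [v1 v1t v1E] := far_atom _ N1.
  have [v2 v2t v2E] := far_atom _ N2.
  have [v3 v3t v3E] := far_atom _ N3.
  case: i i3 => -[|[|[|//]]] ? ->.
  - by exists v1 => //; rewrite /c v1E eqxx.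
  - by exists v2 => //; rewrite /c v2E eqxx (negbTE n21).
  - by exists v3 => //; rewrite /c v3E (negbTE n31) (negbTE n32).
have atomE u v : atom u <> atom v -> exists2 X, [\/ X = X1, X = X2 | X = X3] &
    (X `+` rcoset X (v^-1 * u)%g) u.
  move=> uv; apply: contrapT => nX; apply: uv.
  have XE X : [\/ X = X1, X = X2 | X = X3] -> bit X u = bit X v.
    move=> XX; apply/asboolP/asboolP => [Xu|Xv]; apply: contrapT => nXx;
      apply: nX; exists X => //; [left|right]; split => //.
      by move=> /rcosetP; rewrite invgM invgK mulVKg.
    by apply/rcosetP; rewrite invgM invgK mulVKg.
  by rewrite /atom !XE; [|apply: Or33|apply: Or32|apply: Or31].
have /choice[F FP] : forall g, exists t, forall u X, [\/ X = X1,
  X = X2 | X = X3] ->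
    (X `+` rcoset X g) u -> ~ far H t u.
  move=> g; have [t tP] : exists t, forall u,
      (\bigcup_(X in [set X1; X2; X3]) (X `+` rcoset X g)) u -> ~ far H t u.
    apply: coset_finite_bounded; apply: coset_finite_bigcup.
      by rewrite !finite_setU; do !split; exact: finite_set1.
    by move=> X XX; apply: Xinv; case: XX => [[]|] ->; constructor.
  exists t => u X XX Xu; apply: tP; exists X => //=.
  by case: XX => ->; [left; left|left; right|right].
(* A step of length at most [r] is right multiplication by one of finitely many elements; the
   inverse matches the [v^-1 u] of [atomE]. *)
have [t tP] := finite_set_bounded (fun g => F (g^-1)%g) (finite_vd_ball G r).
exists t => u v uv ut; have [|/eqP] := eqVneq (atom u) (atom v); last first.
  move=> /atomE[X XX Xu]; exfalso; apply: (FP _ _ _ XX Xu).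
  apply: far_le ut; have := tP (u^-1 * v)%g; rewrite invgM invgK; apply.
  by rewrite /= vd1V.
by move=> uE; rewrite /c uE.
Qed.


Lemma rcoset_absorb K k g : subgroup K -> K k ->
  rcoset K (k * g)%g = rcoset K g.
Proof.
move=> /subgroupP[_ KM KV] Kk; apply/seteqP; split => _ [a Ka <-].
  by exists (a * k)%g; [exact: KM|rewrite mulgA].
by exists (a * k^-1)%g; [apply: KM => //; exact: KV|rewrite mulgA mulgVK].
Qed.

Lemma coset_finite_index K H : subgroup K ->
  coset_finite K H -> ~ infinite_index K H.
Proof.
move=> sK [D fD HD]; apply.
apply: (sub_finite_set _ (finite_image (rcoset K) fD)) =>
  _ [h /HD[g Dg [k Kk <-]] <-].
by exists g => //; rewrite rcoset_absorb.
Qed.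

(** If [v] is in [E] and [v g x] is not, then [E] is left either from [v] to [v g] or from [v g] to
    [v g x], so it suffices to treat short elements. The half of the symmetric difference outside
    [E] is a translate of a set of the first kind. *)
Lemma almost_invariant_steps K (E : set G) : 
  (forall g, vd 1%g g <= 1 -> coset_finite K [set v | E v /\ ~ E (v * g)%g]) ->
  forall g, coset_finite K (E `+` rcoset E g).
Proof.
move=> E1; pose S g := [set v | E v /\ ~ E (v * g)%g].
have Sfin g : coset_finite K (S g).
  elim: g / (vd_linked R 1%g g) => [|g x _ Sg _ gx].
    by exists set0 => // v [Ev]; rewrite mulg1.
  have /E1 Sgx : vd 1%g (g^-1 * x)%g <= 1 by rewrite vd1V.
  apply: coset_finite_sub (coset_finiteU Sg (coset_finite_rcoset g^-1 Sgx)).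
  move=> v [Ev nEvx]; have [Evg|] := pselect (E (v * g)%g); last by left.
  by right; apply/rcosetP; rewrite invgK; split; rewrite -?mulgA ?mulVKg.
move=> g; apply: coset_finite_sub (coset_finiteU (Sfin g^-1%g)
  (coset_finite_rcoset g (Sfin g))).
move=> v [[Ev nEv]|[/rcosetP Ev nEv]].
  by left; split => // Evg; apply/nEv/rcosetP.
by right; apply/rcosetP; split; rewrite ?mulgVK.
Qed.

(** * Stabilizers of complementary components *)

Section Stabilizer.
Variables (H : set G) (sH : subgroup H).
Hypothesis H_sub_coends : forall K : set G, subgroup K -> K `<=` H ->
  infinite_index K H -> num_coends R K = 1%:E.
Variables (t : R) (t0 : 0 <= t).

(** The layer of points far from [H] but within 1 of its [t]-neighbourhood is contained in the left
    translates of this finite set by [H]. *)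
Let B : set G := [set b | far H t b /\ vd b 1%g <= t + 1].

Let finite_B : finite_set B.
Proof.
by apply: (sub_finite_set _ (finite_vd_ball G (t + 1))) => b [_ /=];
  rewrite vdC.
Qed.

(* The component [E] of [b] in the complement of a neighbourhood of [H] is
   almost invariant under its stabilizer [K] in [H]: it can only be left
   through the layer [B H], which meets [E] in finitely many cosets of [K].
   So [K] has finite index in [H] unless [E] stays near [H]. *)
Lemma component_dichotomy b : far H t b -> exists s,
  (forall x, linked (far H t) 1 b x -> ~ far H s x) \/
  (forall h, H h -> exists2 x, linked (far H t) 1 b x & vd x h <= s).
Proof.
move=> bt; have [[s sP]|ns] :=
  pselect (exists s, forall x, linked (far H t) 1 b x ->
  ~ far H s x); first by exists s; left.
pose E := [set x | linked (far H t) 1 b x].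
(* Since [H] permutes the components, the stabilizer of [E] can be tested at the single point
   [b]. *)
pose K := [set h | H h /\ E (h * b)%g].
have [H1 HM HV] := (subgroupP H).1 sH.
have KE k x : K k -> E x -> E (k * x)%g.
  move=> [Hk kb] /(linked_subgroupM sH Hk); exact: linked_trans.
have EK k x : H k -> E x -> E (k * x)%g -> K k.
  move=> Hk Ex Ekx; split=> //.
  apply: linked_trans Ekx _; apply: linked_subgroupM => //.
  exact: (linked_sym (@vdC R G)).
have sK : subgroup K.
  apply/subgroupP; split=> [|k l Kk Kl|k Kk].
  - by split=> //; rewrite mul1g; exact: linked_refl.
  - by split; [exact: HM Kk.1 Kl.1|rewrite -mulgA; apply: KE Kl.2].
  - by apply: (EK _ (k * b)%g); [exact: HV Kk.1|exact: Kk.2|rewrite mulKg;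
      exact: linked_refl].
have KH : K `<=` H by move=> k [].
have [infK|finK] := pselect (infinite_index K H); last first.
  (* For finite index, [h = k g] with [g] among finitely many representatives, and the point [k b]
     of [E] is as far from [h] as [b] is from [g]. *)
  have /choice[rep repP] : forall C : set G, exists g : G,
      [set rcoset K h | h in H] C -> H g /\ rcoset K g = C.
    move=> C; have [[h Hh hC]|nC] := pselect ([set rcoset K h | h in H] C).
      by exists h.
    by exists 1%g.
  have [s sP] := finite_set_bounded (fun C => vd b (rep C)) (contrapT finK).
  exists s; right => h Hh.
  have hC : [set rcoset K h | h in H] (rcoset K h) by exists h.
  have [Hg gE] := repP _ hC; have := sP _ hC.
  set g := rep _ in Hg gE *; move=> bg.
  have [k Kk kg] : rcoset K g h.
    by rewrite gE; have [K1 _ _] := (subgroupP K).1 sK; exists 1%g => //;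
      rewrite mul1g.
  exists (k * b)%g; first exact: Kk.2.
  by rewrite -kg vdM.
exfalso; suff : (2%:E <= num_coends R K)%E.
  by rewrite H_sub_coends // lee_fin; lra.
have bddK X : coset_finite K X -> exists r, forall x, X x -> ~ far H r x.
  move=> /coset_finite_bounded[r rP]; exists r => x /rP nx xr; apply: nx.
  by move=> k /KH /xr.
apply: (@num_coends_ge2 _ _ _ E).
- apply: almost_invariant_steps => g g1.
  (* One translate of [b'] in [E] is chosen; any other translate of [b'] by [H] in [E] differs from
     it by an element of [K]. *)
  have /choice[m mP] : forall b' :
    G, exists h, (exists2 h, H h & E (h * b')%g) ->
      H h /\ E (h * b')%g.
    move=> b'; have [[h Hh Eh]|nh] := pselect (exists2 h, H h & E (h * b')%g).
      by exists h.
    by exists 1%g.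
  exists [set (m b' * b')%g | b' in B]; first exact: finite_image.
  move=> v [Ev nEvg]; have vt : far H t v by exact: linked_right Ev.
  have vvg : vd v (v * g)%g <= 1 by rewrite -{1}(mulg1 v) vdM.
  have nvg : ~ far H t (v * g)%g.
    by move=> vgt; apply: nEvg; exact: linked_step Ev _ _.
  have [h Hh hvg] := farN nvg.
  pose b' := (h^-1 * v)%g; have vE : v = (h * b')%g by rewrite mulVKg.
  have Bb' : B b'.
    split; first by apply: far_subgroupM => //; exact: HV.
    by rewrite vdVl mulg1; have := vd_triangle R v (v * g)%g h; lra.
  have [|Hm Em] := mP b'; first by exists h; rewrite -?vE.
  exists (m b' * b')%g; first by exists b'.
  exists (h * (m b')^-1)%g; last by rewrite mulgA mulgVK.
  apply: (EK _ _ _ Em); first by apply: HM => //; exact: HV.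
  by rewrite mulgA mulgVK -vE.
- by move=> /bddK[r rP]; apply: ns; exists r.
(* As [0 <= t], [H] is disjoint from [E]; a [K]-finite complement of [E] would cover [H] by finitely
   many cosets of [K]. *)
- move=> nE; apply: (@coset_finite_index K H) => //.
  apply: coset_finite_sub nE => h Hh Eh; have := linked_right Eh h Hh.
  by rewrite vdxx ltNge t0.
Qed.

(** A chain from [v] to the identity crosses the layer, so up to translation by [H] the component of
    [v] is that of one of the finitely many points of [B]. Taking [r] at least [s] excludes the
    alternative in which the component stays near [H]. *)
Lemma far_linked_aux : exists s r, forall v, far H r v -> forall h, H h ->
  exists2 x, linked (far H t) 1 v x & vd x h <= s.
Proof.
have [H1 HM HV] := (subgroupP H).1 sH.
have /choice[F FP] : forall b, exists s, far H t b ->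
    (forall x, linked (far H t) 1 b x -> ~ far H s x) \/
    (forall h, H h -> exists2 x, linked (far H t) 1 b x & vd x h <= s).
  move=> b; have [/component_dichotomy[s sP]|nb] := pselect (far H t b).
    by exists s.
  by exists 0.
have [s sP] := finite_set_bounded F finite_B.
exists s, (Num.max s t) => v vr h Hh.
have vt : far H t v by apply: far_le vr; rewrite le_max lexx orbT.
have [h0 Hh0 [b Bb vb]] : exists2 h0, H h0 & exists2 b, B b &
    linked (far H t) 1 v (h0 * b)%g.
  have n1 : ~ far H t 1%g by move=> /(_ _ H1); rewrite vdxx ltNge t0.
  have [v1|[x [y [vx ny xy]]]] := linked_exit (vd_linked R v 1%g) vt.
    by case: n1; exact: linked_right v1.
  have [a Ha ya] := farN ny.
  exists a => //; exists (a^-1 * x)%g; last by rewrite mulVKg.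
  split; first by apply: far_subgroupM => //;
    [exact: HV|exact: linked_right vx].
  by rewrite vdVl mulg1; have := vd_triangle R x y a; lra.
have bv : linked (far H t) 1 b (h0^-1 * v)%g.
  rewrite -(mulKg h0 b); apply: linked_subgroupM => //; first exact: HV.
  exact: (linked_sym (@vdC R G)).
have Fs := sP _ Bb.
case: (FP b Bb.1) => [/(_ _ bv)[]|/(_ (h0^-1 * h)%g)[|x bx xh]].
- apply: far_subgroupM => //; first exact: HV.
  by apply: far_le vr; rewrite le_max Fs.
- by apply: HM => //; exact: HV.
- exists (h0 * x)%g; first by apply: linked_trans vb _; exact: linked_subgroupM.
  by rewrite -(mulVKg h0 h) vdM; lra.
Qed.

End Stabilizer.

Lemma far_linked H : subgroup H ->
  (forall K : set G, subgroup K -> K `<=` H ->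
    infinite_index K H -> num_coends R K = 1%:E) ->
  forall t, exists s r, forall v, far H r v -> forall h, H h ->
  exists2 x, linked (far H t) 1 v x & vd x h <= s.
Proof.
move=> sH H_sub t; have t0 : 0 <= Num.max 0 t by rewrite le_max lexx.
have [s [r srP]] := far_linked_aux sH H_sub t0.
exists s, r => v /srP{}srP h /srP[x vx xh]; exists x => //.
by apply: linked_subset vx => y; apply: far_le; rewrite le_max lexx orbT.
Qed.

End Coends.

(** * Quasi-isometries between vertex sets *)

Section VertexQI.
Variables (R : realType) (G G' : fgGroup).
Local Notation vd := (@vd R _).
Implicit Types (L C r s t : R).

(** A coarse inverse is part of the data, the lower bound is written without division, and one pair
    of constants serves all inequalities. *)
Definition vertex_qi (phi : G -> G') (psi : G' -> G) L C :=
  [/\ 0 <= L, 0 <= C, forall u v, vd (phi u) (phi v) <= L * vd u v + C,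
      forall u v, vd u v <= L * vd (phi u) (phi v) + C &
      [/\ forall u v, vd (psi u) (psi v) <= L * vd u v + C,
      forall v, vd v (phi (psi v)) <= C & forall u, vd u (psi (phi u)) <= C]].

Lemma quasi_isometry_vertex_qi (f : cayley R G -> cayley R G') :
  quasi_isometry (@mdist R (cayley R G)) (@mdist R (cayley R G')) f ->
  exists phi psi L C, vertex_qi phi psi L C /\
    forall u, mdist (f (vertex R u)) (vertex R (phi u)) <= 1.
Proof.
move=> [L [C [L1 C0 fLC f_onto]]]; have L0 : 0 < L by lra.
have /choice[phi phiP] := fun u => near_vertex (f (vertex R u)).
have up u v : vd (phi u) (phi v) <= L * vd u v + (C + 2).
  have /andP[_ fuv] := fLC (vertex R u) (vertex R v).
  have := metric_triangle (vertex R (phi u)) (f (vertex R u)) (vertex R (phi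
    v)).
  have := metric_triangle (f (vertex R u)) (f (vertex R v)) (vertex R (phi v)).
  have := phiP u; have := phiP v;
    rewrite (metric_sym (f (vertex R u)) (vertex R (phi u))) !vdE; lra.
have low u v : vd u v <= L * vd (phi u) (phi v) + L * (C + 2).
  have /andP[fuv _] := fLC (vertex R u) (vertex R v).
  rewrite -mulrDr -ler_pdivrMl // vdE.
  have := metric_triangle (f (vertex R u)) (vertex R (phi u)) (f (vertex R v)).
  have := metric_triangle (vertex R (phi u)) (vertex R (phi v)) (f (vertex R
    v)).
  have := phiP u; have := phiP v;
    rewrite (metric_sym (f (vertex R v)) (vertex R (phi v))) !vdE; lra.
(* The constant adds [C] to reach a point [f x], [L + C] to move [x] to a vertex [u], and 1 to pass
   to [phi u]. *)
have /choice[psi psiP] : forall v, exists u, vd v (phi u) <= 2 * C + L + 1.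
  move=> v; have [x vx] := f_onto (vertex R v); have [u xu] := near_vertex x.
  exists u; have /andP[_ fxu] := fLC x (vertex R u).
  have := metric_triangle (vertex R v) (f x) (vertex R (phi u)).
  have := metric_triangle (f x) (f (vertex R u)) (vertex R (phi u)).
  have : L * mdist x (vertex R u) <= L * 1 by rewrite ler_wpM2l // ltW.
  have := phiP u; rewrite !vdE; lra.
pose C1 := 2 * C + L + 1.
have C10 : 0 <= C1 by rewrite /C1; lra.
have LC : 0 <= L * C by rewrite mulr_ge0 // ltW.
have LC1 : 0 <= L * C1 by rewrite mulr_ge0 // ltW.
exists phi, psi, L, (L * (2 * C1 + C + 2) + C1 + C + 2); split=> //; split=> //.
- by apply: ltW.
- lra.
- move=> u v; have := up u v; lra.
- move=> u v; have := low u v; lra.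
- split=> [u v|v|u].
  + have := low (psi u) (psi v).
    have : L * vd (phi (psi u)) (phi (psi v)) <= L * (vd u v + 2 * C1).
      apply: ler_wpM2l; first exact: ltW.
      have := vd_triangle R (phi (psi u)) u (phi (psi v)).
      have := vd_triangle R u v (phi (psi v)).
      by have := psiP u; have := psiP v; rewrite (vdC R u (phi (psi u))) /C1;
        lra.
    lra.
  + by have := psiP v; rewrite -/C1; lra.
  + have := low u (psi (phi u)).
    have : L * vd (phi u) (phi (psi (phi u))) <= L * C1.
      by apply: ler_wpM2l; [exact: ltW|exact: psiP].
    lra.
Qed.

Variables (phi : G -> G') (psi : G' ->
  G) (L C : R) (qi : vertex_qi phi psi L C).
Variable H : set G.
Local Notation A := (phi @` H).
Local Notation far := (far vd).
Local Notation linked := (linked vd).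

Lemma far_psi t v : far A (L * t + 2 * C) v -> far H t (psi v).
Proof.
have [L0 C0 up low [upsi phipsi psiphi]] := qi.
move=> vt h Hh; rewrite ltNge; apply/negP => vh.
have : L * t + 2 * C < vd v (phi h) by apply: vt; exists h.
have := vd_triangle R v (phi (psi v)) (phi h).
have := up (psi v) h; have := ler_wpM2l L0 vh; have := phipsi v; lra.
Qed.

Lemma far_phi t u : far H (L * t + C) u -> far A t (phi u).
Proof.
have [L0 C0 up low [upsi phipsi psiphi]] := qi.
move=> ut _ [h Hh <-]; rewrite ltNge; apply/negP => uh.
have := ut h Hh; have := low u h; have := ler_wpM2l L0 uh; lra.
Qed.

Lemma transfer_colouring (c : G -> 'I_3) :
  (forall r, exists t, forall u v, vd u v <= r -> far H t u -> c u = c v) ->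
  forall r, exists t, forall u v, vd u v <= r -> far A t u ->
    (c \o psi) u = (c \o psi) v.
Proof.
have [L0 C0 up low [upsi phipsi psiphi]] := qi.
move=> cH r; have [t tP] := cH (L * r + C); exists (L * t + 2 * C) => u v uv uA.
apply: tP; last exact: far_psi.
by have := upsi u v; have := ler_wpM2l L0 uv; lra.
Qed.

Lemma transfer_colours (c : G -> 'I_3) :
  (forall r, exists t, forall u v, vd u v <= r -> far H t u -> c u = c v) ->
  (forall i t, exists2 v, far H t v & c v = i) ->
  forall i t, exists2 v, far A t v & (c \o psi) v = i.
Proof.
have [L0 C0 up low [upsi phipsi psiphi]] := qi.
move=> cH ci i t; have [t0 t0P] := cH C.
have [u ut ui] := ci i (Num.max t0 (L * t + C)).
exists (phi u); first by apply/far_phi/(far_le _ ut); rewrite le_max lexx orbT.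
rewrite /= -ui; apply/esym/t0P => //.
by apply: far_le ut; rewrite le_max lexx.
Qed.

(** Chains are pushed forward by [phi], which turns steps of length 1 into steps of length [L + C];
    one further step joins [v] to [phi (psi v)]. *)
Lemma transfer_far_linked :
  (forall t, exists s r, forall v, far H r v -> forall h, H h ->
     exists2 x, linked (far H t) 1 v x & vd x h <= s) ->
  forall t, exists s r, forall v, far A r v -> forall a, A a ->
    exists2 x, linked (far A t) (L + C) v x & vd x a <= s.
Proof.
have [L0 C0 up low [upsi phipsi psiphi]] := qi.
move=> HP t; have [s [r srP]] := HP (L * t + C).
exists (L * s + C), (Num.max t (L * r + 2 * C)) => v vr _ [h Hh <-].
have /srP/(_ h Hh)[x vx xh] : far H r (psi v).
  by apply: far_psi; apply: far_le vr; rewrite le_max lexx orbT.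
exists (phi x); last by have := up x h; have := ler_wpM2l L0 xh; lra.
have px : linked (far A t) (L + C) (phi (psi v)) (phi x).
  apply: linked_map vx => [z|u w uw]; first exact: far_phi.
  by have := up u w; have := ler_wpM2l L0 uw; lra.
apply: linked_trans px; apply: linked1.
- by apply: far_le vr; rewrite le_max lexx.
- by have /far_phi := linked_left vx.
- by have := phipsi v; lra.
Qed.

End VertexQI.

(** * Noncrossing translates *)

Section Noncrossing.
Variables (R : realType) (G : fgGroup).
Local Notation vd := (@vd R _).
Local Notation far := (far vd).
Local Notation linked := (linked vd).
Local Notation vx := (vertex R).
Implicit Types (a b g h u v w : G) (x y z p : cayley R G) (r s t k : R).

(** [Af] stands for [f(H)], which the noncrossing condition concerns; [A] is the nearby set of
    vertices, to which colours and chains refer. *)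
Variables (A : set G) (Af : set (cayley R G)).
Hypothesis A_near_Af : forall a, A a -> exists2 p, Af p & mdist p (vx a) <= 1.
Hypothesis Af_near_A : forall p, Af p -> exists2 a, A a & mdist p (vx a) <= 1.

Variable c : G -> 'I_3.
Hypothesis c_const : forall r, exists t, forall u v,
  vd u v <= r -> far A t u -> c u = c v.
Hypothesis c_far : forall i t, exists2 v, far A t v & c v = i.

Variables (rho : R).
Hypothesis rho0 : 0 <= rho.
Hypothesis A_linked : forall t, exists s r, forall v, far A r v ->
  forall a, A a -> exists2 x, linked (far A t) rho v x & vd x a <= s.

Lemma mdist_translateV g x y :
  mdist (translate g x) y = mdist x (translate (g^-1)%g y).
Proof. by rewrite -(mdist_translate g x) translateVK. Qed.

(** By left invariance these are the points at distance more than [t] from every point of [g A];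
    [coset_colour g] is the colouring moved along with [A]. *)
Definition far_in g t : set G := [set v | far A t (g^-1 * v)%g].

Definition coset_colour g v := c (g^-1 * v)%g.

Lemma linked_translate g t v w : linked (far A t) rho v w ->
  linked (far_in g t) rho (g * v)%g (g * w)%g.
Proof.
apply: linked_map => [z zt|x y]; last by rewrite vdM.
by rewrite /far_in /= mulKg.
Qed.

(** * Translates of a neighbourhood of fixed radius *)

Section Radius.
Variables (r : R) (r0 : 0 <= r).
(** Steps of length 3 arise when two points of the graph at distance at most 1 are replaced by
    vertices within 1 of them. *)
Variable t3 : R.
Hypothesis t3P : forall u v, vd u v <= 3 -> far A t3 u -> c u = c v.
Hypothesis t3r : t3 + 2 <= r.
Variable t1 : R.
Hypothesis t1P : forall u v, vd u v <= rho -> far A t1 u -> c u = c v.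
Variable k : R.

Definition thick g : set (cayley R G) := translate g @` unif_nbhd r Af.

Hypothesis thickP : forall a b, thick a <> thick b ->
  exists2 C, deep_component (thick b) C & thick a `<=` unif_nbhd k C.


(** The 2 pays for the infimum in [unif_nbhd] and for the passage from [Af] to [A]. *)
Lemma far_in_thickN g v e x :
  far_in g (e + r + 2) v -> mdist x (vx v) <= e -> ~ thick g x.
Proof.
move=> vfar + [y Yy yx]; rewrite -yx mdist_translateV translate_vertex => yv.
have [p Afp yp] := unif_nbhdP (ltr01 : 0 < 1 :> R) Yy.
have [a Aa pa] := Af_near_A Afp.
have := vfar a Aa; rewrite vdE.
have := metric_triangle (vx (g^-1 * v)%g) y (vx a).
have := metric_triangle y p (vx a); rewrite metric_sym in yv.
by rewrite ltNge => ? ? /negP; apply; lra.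
Qed.

Lemma thickN_far_in g v e x :
  ~ thick g x -> mdist x (vx v) <= e -> far_in g (r - e - 1) v.
Proof.
move=> nx xv a Aa; have [p Afp ap] := A_near_Af Aa.
have nY : ~ unif_nbhd r Af (translate (g^-1)%g x).
  by move=> Yx; apply: nx; exists (translate (g^-1)%g x) => //;
    exact: translateVK.
have := unif_nbhdN nY Afp.
have := metric_triangle (translate (g^-1)%g x) (vx (g^-1 * v)%g) p.
have := metric_triangle (vx (g^-1 * v)%g) (vx a) p.
by rewrite metric_sym in ap; rewrite vdE -translate_vertex mdist_translate; lra.
Qed.

(** A component is connected, so its points are joined by 1-chains inside it; nearby vertices along
    the chain are far enough from [g A] for the colour not to change. *)
Lemma component_colour g x y u v : connected_component (~` thick g) x y ->
  mdist x (vx u) <= 1 -> mdist y (vx v) <= 1 ->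
    coset_colour g u = coset_colour g v.
Proof.
move=> xy xu yv; have /choice[nv nvP] := @near_vertex R G.
have step (z w : cayley R G) u' v' : ~ thick g z -> mdist z w <= 1 ->
    mdist z (vx u') <= 1 -> mdist w (vx v') <= 1 ->
      coset_colour g u' = coset_colour g v'.
  move=> nz zw zu wv; apply: t3P.
    rewrite vdM vdE; have := metric_triangle (vx u') z (vx v').
    by have := metric_triangle z w (vx v'); rewrite metric_sym in zu; lra.
  by apply: far_le (thickN_far_in nz zu); move: t3r; lra.
have nthick z : connected_component (~` thick g) x z -> ~ thick g z.
  exact: connected_component_sub.
have xx : connected_component (~` thick g) x x.
  exact: connected_component_trans xy (connected_component_sym xy).
have xyl := connected_linked (ltr01 :
  0 < 1 :> R) (@component_connected _ _ x) xx xy.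
have nE : coset_colour g (nv x) = coset_colour g (nv y).
  apply: (linked_ind_const (c :=
    fun z => coset_colour g (nv z)) _ xyl) => z w xz xw zw.
  by apply: step (nvP z) (nvP w) => //; exact: nthick.
rewrite (step x x u (nv x)) ?mdistxx ?nE //; last exact: nthick.
by apply: (step y y) => //; rewrite ?mdistxx //; exact: nthick.
Qed.

Hypothesis t1_ge : k + rho + r + 4 <= t1.

Lemma far_in_linked_colour g v w : linked (far_in g t1) rho v w ->
  coset_colour g v = coset_colour g w.
Proof.
by apply: linked_ind_const => x y xt _ xy; apply: t1P => //; rewrite vdM.
Qed.

(* A chain far from [b A] that avoids the component [C] of the complement of
   [thick b] close to [thick a] cannot meet [thick a], and all the points
   in [C] have the same colour [l]. *)
Lemma thick_linked_component a b : thick a <> thick b ->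
  exists l, forall u v, linked (far_in b t1) rho u v -> coset_colour b u <> l ->
  connected_component (~` thick a) (vx u) (vx v).
Proof.
move=> /thickP[C [[x0 nx0 CE] _] aC]; have [v0 xv0] := near_vertex x0.
exists (coset_colour b v0).
(* If [z] were in [thick a], it would be within [k + 1] of a point of [C]; a path of length below
   [rho + k + 2], missing [thick b], would put [w] in [C] and give it the colour of [C]. *)
have avoid w z : far_in b t1 w -> coset_colour b w <> coset_colour b v0 ->
    mdist (vx w) z < rho + 1 -> ~ thick a z.
  move=> wt wl wz /aC/(unif_nbhdP (ltr01 : 0 < 1 :> R))[p Cp zp]; apply: wl.
  rewrite CE in Cp; apply: (@component_colour _ (vx w) x0);
    rewrite ?mdistxx ?ler01 //.
  apply: connected_component_trans (connected_component_sym Cp).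
  apply: (@cayley_component _ _ _ _ _ (rho + k + 2)).
    by have := metric_triangle (vx w) z p; move: rho0; lra.
  move=> q wq; apply: (@far_in_thickN _ w (rho + k + 2)).
    by apply: far_le wt; move: t1_ge; lra.
  by rewrite metric_sym ltW.
move=> u v uv ul; elim: v / uv => [ut|v w uv IH wt vw].
  apply: connected_component_refl; apply: (avoid u) => //.
  by rewrite mdistxx; move: rho0; lra.
apply: connected_component_trans IH _.
have vt := linked_right uv.
apply: (@cayley_component _ _ _ _ _ (rho + 1)); first by rewrite -vdE; lra.
by move=> z; apply: avoid => //; rewrite -(far_in_linked_colour uv).
Qed.

(** Points far from [a A] whose colour is not [l] travel, without meeting [thick b], to a
    neighbourhood of [a q]. That neighbourhood also misses [thick b], so all of them lie in one
    component. *)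
Lemma thick_far_component : exists s r1, forall a b q,
  A q -> far_in b s (a * q)%g -> exists l, forall v w x y : G,
    far_in a r1 v -> far_in a r1 w -> coset_colour a v <> l ->
      coset_colour a w <> l ->
    linked (far_in a t1) rho v x -> linked (far_in a t1) rho w y ->
    connected_component (~` thick b) (vx x) (vx y).
Proof.
have [s [r1 srP]] := A_linked t1; pose s1 := `|s|;
  have s10 : 0 <= s1 by exact: normr_ge0.
have ss1 : s <= s1 by exact: ler_norm.
(* Both chains end within [s1] of [a q], and a ball of radius [2 * s1 + 1] around one of these ends
   must miss [thick b]. *)
exists (3 * s1 + r + 3), r1 => a b q Aq aqs.
(* The two translates differ since a point within 1 of [a q] belongs only to [thick a]; the
   noncrossing condition therefore applies. *)
have ab : thick b <> thick a.
  move=> ab; have [p Afp qp] := A_near_Af Aq.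
  have : thick b (translate a p).
    by rewrite ab; exists p => //; apply: unif_nbhd_in Afp _; rewrite mdistxx.
  apply: (@far_in_thickN _ (a * q)%g 1); first by apply: far_le aqs; lra.
  by rewrite -translate_vertex mdist_translate.
have [l lP] := thick_linked_component ab;
  exists l => v w x y vr wr vl wl vx' wy.
have reach u : far_in a r1 u -> coset_colour a u <> l -> exists2 z : G,
    connected_component (~` thick b) (vx u) (vx z) & vd z (a * q)%g <= s1.
  move=> /srP/(_ q Aq)[z uz zq] ul; exists (a * z)%g; last by rewrite vdM; lra.
  by apply: lP => //; rewrite -{1}(mulVKg a u); exact: linked_translate.
have [v' vv' v'q] := reach v vr vl; have [w' ww' w'q] := reach w wr wl.
apply: connected_component_trans (lP _ _ wy wl).
apply: connected_component_trans (connected_component_sym (lP _ _ vx' vl)) _.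
apply: connected_component_trans vv' _.
apply: connected_component_trans (connected_component_sym ww').
apply: (@cayley_component _ _ _ _ _ (2 * s1 + 1)).
  by rewrite -vdE; have := vd_triangle R v' (a * q)%g w';
    rewrite (vdC R (a * q)%g w'); lra.
move=> z v'z; apply: (@far_in_thickN _ (a * q)%g (3 * s1 + 1)).
  by apply: far_le aqs; lra.
have := metric_triangle z (vx v') (vx (a * q)%g).
by rewrite metric_sym in v'z; move: v'q; rewrite vdE; lra.
Qed.

End Radius.

Hypothesis A_noncrossing : exists2 r0 : R, 0 <= r0 & forall r, r0 <= r ->
  noncrossing (@translate R G) (unif_nbhd r Af).

(** The noncrossing condition in the form used below, with components replaced by colours and all
    constants uniform in [a], [b] and [q]. *)
Lemma far_colours : exists s r1 t1,
  (forall u v, vd u v <= rho -> far A t1 u -> c u = c v) /\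
  forall a b q, A q -> far_in b s (a * q)%g -> exists l, forall v w x y : G,
    far_in a r1 v -> far_in a r1 w -> coset_colour a v <> l ->
      coset_colour a w <> l ->
    linked (far_in a t1) rho v x -> linked (far_in a t1) rho w y ->
    coset_colour b x = coset_colour b y.
Proof.
have [t3 t3P] := c_const 3; have [t2 t2P] := c_const rho.
have [r0 r00 ncP] := A_noncrossing; pose r := Num.max r0 (t3 + 2).
have r0r : 0 <= r by rewrite le_max r00.
have t3r : t3 + 2 <= r by rewrite le_max lexx orbT.
have [k _ kP] : noncrossing (@translate R G) (unif_nbhd r Af).
  by apply: ncP; rewrite le_max lexx.
pose t1 := Num.max t2 (k + rho + r + 4).
have t1P u v : vd u v <= rho -> far A t1 u -> c u = c v.
  by move=> uv ut; apply: t2P uv _; apply: far_le ut; rewrite le_max lexx.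
have t1_ge : k + rho + r + 4 <= t1 by rewrite le_max lexx orbT.
have [s [r1 srP]] := thick_far_component r0r t3P t3r t1P kP t1_ge.
exists s, r1, t1; split => // a b q Aq aqs; have [l lP] := srP a b q Aq aqs.
exists l => v w x y vr wr vl wl vx' wy.
apply: (component_colour t3P t3r (lP v w x y vr wr vl wl vx' wy));
  by rewrite mdistxx ler01.
Qed.

(** * The coarse stabilizer of the set and its colouring *)

Definition near_set g t := forall a, A a -> ~ far A t (g * a)%g.

Lemma near_setM g h s t : near_set g s -> near_set h t ->
  near_set (g * h)%g (s + t).
Proof.
move=> gs ht a Aa; have [a' Aa' ha'] := farN (ht a Aa).
have [b Ab gb] := farN (gs a' Aa') => /(_ b Ab); apply/negP;
  rewrite -leNgt -mulgA.
have := vd_triangle R (g * (h * a))%g (g * a')%g b; rewrite vdM; lra.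
Qed.

Lemma far_near_set g s t v : near_set g s -> far A (t + s) v ->
  far A t (g^-1 * v)%g.
Proof.
move=> gs vt a Aa; have [b Ab gab] := farN (gs a Aa).
have := vt b Ab; have := vd_triangle R v (g * a)%g b; rewrite vdVl; lra.
Qed.

Lemma near_set_le g s t : s <= t -> near_set g s -> near_set g t.
Proof. by move=> st gs a /gs ga gat; apply: ga; exact: far_le gat. Qed.

(** Using both [g] and its inverse puts [g A] and [A] at finite Hausdorff distance. Letting [t]
    depend on [g] makes this set closed under products; uniformity is recovered in
    [coarse_stab_near]. *)
Definition coarse_stab : set G := [set g | exists t,
  [/\ near_set g t, near_set (g^-1)%g t &
      forall v, far A t v -> c (g * v)%g = c v]].

Lemma coarse_stab_subgroup : subgroup coarse_stab.
Proof.
apply/subgroupP; split.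
- exists 0; rewrite invg1; split=> [a Aa|a Aa|v _]; rewrite mul1g //;
  by move=> /(_ a Aa); rewrite vdxx ltxx.
- move=> g h [s [gs gVs cg]] [t [ht hVt ch]].
  pose m := Num.max (s + t) (Num.max (t + s) t).
  exists m; split.
  + by apply: near_set_le (near_setM gs ht); rewrite le_max lexx.
  + by rewrite invgM; apply: near_set_le (near_setM hVt gVs);
      rewrite !le_max lexx orbT.
  + move=> v vm; rewrite -mulgA cg; last first.
      rewrite -(invgK h); apply: far_near_set hVt _.
      by apply: far_le vm; rewrite le_max lexx.
    by apply: ch; apply: far_le vm; rewrite !le_max lexx !orbT.
- move=> g [t [gt gVt cg]]; pose m := Num.max t (t + t).
  exists m; rewrite invgK; split.
  + by apply: near_set_le gVt; rewrite le_max lexx.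
  + by apply: near_set_le gt; rewrite le_max lexx.
  + move=> v vm; rewrite -cg ?mulVKg //; apply: far_near_set gt _.
    by apply: far_le vm; rewrite le_max lexx orbT.
Qed.

(** This is where three colours enter: two distinct ones remain after the exceptional colour is
    excluded. *)
Lemma two_other_colours (l : 'I_3) : exists i j, [/\ i <> l, j <> l & i <> j].
Proof.
by case: l => -[|[|[|//]]] ?;
  [exists (inord 1), (inord 2)|exists (inord 0), (inord 2)
  |exists (inord 0), (inord 1)]; split=> /(congr1 val); rewrite /= ?inordK.
Qed.

(** If [g q] were far from [A], [far_colours] would give [g v] and [g w] the same colour for some
    far points [v], [w] of different colours, whereas [g] preserves colours far from [A]. *)
Lemma coarse_stab_near : exists s, forall g, coarse_stab g -> near_set g s.
Proof.
have [s [r1 [t1 [_ sP]]]] := far_colours.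
exists s => g [t [gt gVt cg]] q Aq qs.
have [|l lP] := sP g 1%g q Aq; first by rewrite /far_in /= invg1 mul1g.
have [i [j [il jl ij]]] := two_other_colours l.
pose m := Num.max t (Num.max r1 t1).
have [v vm vi] := c_far i m; have [w wm wj] := c_far j m.
have mt : t <= m by rewrite le_max lexx.
have mr1 : r1 <= m by rewrite !le_max lexx orbT.
have mt1 : t1 <= m by rewrite !le_max lexx !orbT.
apply: ij; rewrite -vi -wj -(cg v) -?(cg w);
  [|exact: far_le wm|exact: far_le vm].
have := lP (g * v)%g (g * w)%g (g * v)%g (g * w)%g.
rewrite /far_in /coset_colour /= !mulKg invg1 !mul1g; apply; rewrite ?vi ?wj //.
- exact: far_le vm.
- exact: far_le wm.
- by apply: linked_refl; rewrite /= mulKg; exact: far_le vm.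
- by apply: linked_refl; rewrite /= mulKg; exact: far_le wm.
Qed.

Lemma coarse_stab_same_colours : exists s, forall h1 h2, A h1 -> A h2 ->
  (forall v, vd 1%g v <= s -> c (h1 * v)%g = c (h2 * v)%g) ->
  coarse_stab (h1 * h2^-1)%g.
Proof.
have [s' [r1 [t1 [t1P sP]]]] := far_colours.
have [s1 [r1' s1P]] := A_linked t1.
(* The chain from [v] must stay far from [A], and so must its translate by [g], which may be closer
   to [A] by [s']. *)
have [tr trP] := c_const rho; pose t2 := Num.max tr (tr + s').
have [s2 [r2 s2P]] := A_linked t2.
exists (Num.max s1 s2) => h1 h2 Ah1 Ah2 same.
(* Otherwise two far colours other than [l] are brought along chains to points [x], [y] near [h].
   Equal patterns show both colours near [h'] too, while [far_colours] makes them equal there. *)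
have near h h' : A h -> A h' ->
    (forall v, vd 1%g v <= s1 -> c (h * v)%g = c (h' * v)%g) ->
    near_set (h' * h^-1)%g s'.
  move=> Ah Ah' hh' q Aq qs.
  have [|l lP] := sP (h^-1)%g (h'^-1)%g q Aq;
    first by rewrite /far_in /= invgK mulgA.
  have [i [j [il jl ij]]] := two_other_colours l; pose m := Num.max r1 r1'.
  have mr1 : r1 <= m by rewrite le_max lexx.
  have mr1' : r1' <= m by rewrite le_max lexx orbT.
  have [v vm vi] := c_far i m; have [w wm wj] := c_far j m.
  have [x vx' xh] := s1P v (far_le mr1' vm) h Ah.
  have [y wy yh] := s1P w (far_le mr1' wm) h Ah.
  have xE : c x = i by rewrite -(linked_ind_const (c :=
    c) _ vx') // => a b ? _ /t1P; apply.
  have yE : c y = j by rewrite -(linked_ind_const (c :=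
    c) _ wy) // => a b ? _ /t1P; apply.
  apply: ij; rewrite -xE -yE -(mulVKg h x) -(mulVKg h y).
  rewrite hh' ?hh'; [|by rewrite vd1V vdC|by rewrite vd1V vdC].
  have := lP (h^-1 * v)%g (h^-1 * w)%g (h^-1 * x)%g (h^-1 * y)%g.
  rewrite /far_in /coset_colour /= !mulKg !invgK; apply;
    rewrite ?mulVKg ?vi ?wj //.
  - exact: far_le vm.
  - exact: far_le wm.
  - by have := linked_translate (h^-1)%g vx'; rewrite /far_in /= invgK.
  - by have := linked_translate (h^-1)%g wy; rewrite /far_in /= invgK.
have near12 : near_set (h1 * h2^-1)%g s'.
  by apply: near => // v vs; rewrite same // le_max vs.
have near21 : near_set (h2 * h1^-1)%g s'.
  by apply: near => // v vs; rewrite same // le_max vs.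
exists (Num.max s' r2); rewrite invgM invgK; split.
- by apply: near_set_le near12; rewrite le_max lexx.
- by apply: near_set_le near21; rewrite le_max lexx.
(* [v] is moved to a point [x] near [h2] without changing its colour or that of its translate; then
   [x] and [g x] occupy the same position in the two patterns. *)
move=> v vr; set g := (h1 * h2^-1)%g.
have [|x vx' xh] := s2P v _ h2 Ah2; first by apply: far_le vr;
  rewrite le_max lexx orbT.
have -> : c v = c x.
  apply: (linked_ind_const (c := c) _ vx') => a b aP _ ab; apply: trP => //.
  by apply: far_le aP; rewrite le_max lexx.
have -> : c (g * v)%g = c (g * x)%g.
  apply: (linked_ind_const (c := fun u => c (g * u)%g) _ vx') => a b aP _ ab.
  apply: trP; first by rewrite vdM.
  have -> : g = ((h2 * h1^-1)^-1)%g by rewrite invgM invgK.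
  by apply: (far_near_set near21); apply: far_le aP; rewrite le_max lexx orbT.
rewrite /g -mulgA same ?mulVKg //.
by rewrite vd1V vdC le_max xh orbT.
Qed.

(** Finitely many patterns occur on a ball. If [h] represents the pattern at [a], then [a h^-1] is
    in the stabilizer, at distance from [a] equal to the length of [h]. Conversely [g] is within a
    constant of [g a0], which is near [A]. *)
Lemma coarse_stab_hausdorff a0 : A a0 -> exists t,
  (forall g, coarse_stab g -> ~ far A t g) /\ forall a, A a ->
    ~ far coarse_stab t a.
Proof.
move=> Aa0; have [s sP] := coarse_stab_near.
have [s2 s2P] := coarse_stab_same_colours.
have /finite_seqP[w wE] := finite_vd_ball G s2.
pose mark a : (size w).-tuple 'I_3 :=
  map_tuple (fun v => c (a * v)%g) (in_tuple w).
have /choice[rep repP] : forall m :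
  (size w).-tuple 'I_3, exists h, forall a, A a -> mark a = m ->
    A h /\ mark h = m.
  move=> m; have [[h Ah hm]|nh] := pselect (exists2 h, A h & mark h = m).
    by exists h.
  by exists 1%g => a Aa am; exfalso; apply: nh; exists a.
have [t tP] := finite_set_bounded (fun m =>
  vd 1%g (rep m)) (@finite_finset _ [set: (size w).-tuple 'I_3]).
exists (Num.max t (vd 1%g a0 + s)); split.
  move=> g /sP/(_ a0 Aa0) gs; have [b Ab gb] := farN gs.
  move=> /(_ b Ab); apply/negP; rewrite -leNgt le_max.
  apply/orP; right; have := vd_triangle R g (g * a0)%g b.
  by rewrite -{2}(mulg1 g) vdM; lra.
move=> a Aa; have [Ah hm] := repP _ _ Aa erefl; set h := rep _ in Ah hm *.
have stab : coarse_stab (a * h^-1)%g.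
  apply: s2P => // v vs; have vw : v \in w by have : [set` w] v by rewrite -wE.
  by have /(congr1 val)/eq_in_map := hm => /(_ v vw).
move=> /(_ _ stab); apply/negP; rewrite -leNgt le_max.
rewrite -{1}(mulg1 a) vdM (_ : vd _ _ = vd 1%g h) ?tP //.
by rewrite -(vdM R h) mulg1 mulgV vdC.
Qed.

End Noncrossing.

(** * Finite generation and word metrics *)

Section WordMetric.
Variables (R : realType) (G : fgGroup).
Local Notation vd := (@vd R _).
Implicit Types (H S : set G) (g h x y : G) (r : R).

Lemma generated_subgroup H S : generates S H -> subgroup H.
Proof.
move=> [_ <-]; apply/subgroupP; split.
- by move=> K [/subgroupP[]].
- move=> x y Hx Hy K KS; have [/subgroupP[_ KM _] _] := KS.
  by apply: KM; [exact: Hx|exact: Hy].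
- move=> x Hx K KS; have [/subgroupP[_ _ KV] _] := KS.
  by apply: KV; exact: Hx.
Qed.

Lemma generates_word H S g : generates S H -> H g <-> exists n, is_word S n g.
Proof. by move=> [_ <-]; exact: generatedP. Qed.

Lemma generator_in H S s : generates S H -> S s \/ S (s^-1)%g -> H s.
Proof.
by move=> SH Ss; apply/(generates_word _ SH); exists 1%N; exact: is_word1.
Qed.

Lemma generators_bounded S : finite_set S ->
  exists r, forall s, S s \/ S (s^-1)%g -> vd 1%g s <= r.
Proof.
move=> fS; have [r rP] := finite_set_bounded (vd 1%g) fS.
exists r => s [/rP//|/rP]; by rewrite -(vdM R s) mulg1 mulgV vdC.
Qed.

(** Finite generation is coarse connectedness: the quotients of successive points of a chain are
    short elements of [H], of which there are finitely many. *)
Lemma fin_gen_linked H : subgroup H ->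
  fin_gen H <-> exists r, forall h, H h -> linked vd H r 1%g h.
Proof.
move=> sH; have [H1 HM HV] := (subgroupP H).1 sH; split=> [[S SH]|[r rP]].
  have [r rP] := generators_bounded SH.1;
    exists r => h /(generates_word _ SH)[n].
  move: n h; apply: is_word_ind; first exact: linked_refl.
  move=> g x g1 Sx.
  apply: (linked_step g1).
    by apply: HM; [exact: linked_right g1|exact: generator_in Sx].
  by rewrite -{1}(mulg1 g) vdM rP.
pose S := [set h | H h /\ vd 1%g h <= r]; exists S; split.
  by apply: sub_finite_set (finite_vd_ball G r) => h [].
apply/seteqP; split; first by apply: smallest_sub => // h [].
move=> h /rP; elim=> [_|x y Hx IH Hy xy] K KS;
  have [/subgroupP[K1 KM _] SK] := KS => //.
rewrite -(mulVKg x y); apply: KM; first exact: IH.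
apply: SK; split; last by rewrite vd1V.
by apply: HM => //; apply: HV; exact: linked_right Hx.
Qed.

(** Only finitely many elements of [H] lie in a ball of [G], so their word lengths in [S] have a
    common bound. *)
Lemma bounded_word H S : generates S H -> forall r, exists N : nat, forall x y,
  H x -> H y -> vd x y <= r -> exists2 m, (m <= N)%N & is_word S m (x^-1 * y)%g.
Proof.
move=> SH r; have [H1 HM HV] := (subgroupP H).1 (generated_subgroup SH).
have /choice[l lP] : forall g, exists n, H g -> is_word S n g.
  move=> g; have [/(generates_word _ SH)[n gn]|nH] := pselect (H g);
    first by exists n.
  by exists 0%N.
have [M MP] := finite_set_bounded (fun g => (l g)%:R : R) (finite_vd_ball G r).
exists (Num.truncn M) => x y Hx Hy xy;
  have Hxy : H (x^-1 * y)%g by apply: HM => //; exact: HV.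
exists (l (x^-1 * y)%g); last exact: lP.
have lM : (l (x^-1 * y)%g)%:R <= M by apply: MP; rewrite /= vd1V.
by rewrite truncn_ge_nat //; exact: le_trans lM.
Qed.

Lemma word_dist_le S n x y : is_word S n (x^-1 * y)%g ->
  word_dist R S x y <= n%:R.
Proof.
move=> xy; apply: ge_inf; last by exists n.
by exists 0 => _ [m _ <-].
Qed.

Lemma word_dist_adherent H S x y : generates S H -> H x -> H y ->
  exists2 n, is_word S n (x^-1 * y)%g & n%:R <= word_dist R S x y + 1.
Proof.
move=> SH Hx Hy; have [H1 HM HV] := (subgroupP H).1 (generated_subgroup SH).
have [|_ [n wn <-] /ltW nl] := @inf_adherent R
    [set n%:R | n in [set n | is_word S n (x^-1 * y)%g]] 1 ltr01;
      last by exists n.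
split; last by exists 0 => _ [m _ <-].
have /(generates_word _ SH)[n wn] : H (x^-1 * y)%g by apply: HM => //;
  exact: HV.
by exists n%:R, n.
Qed.

End WordMetric.

(** * Coarse maps between subgroups *)

Section CoarseMap.
Variables (R : realType).
Local Notation vd := (@vd R _).

(** Distances are those of the ambient groups, so the notion makes sense before [H] is known to be
    finitely generated. *)
Definition coarse_map (G G' : fgGroup) (H : set G) (H' : set G') (p : G ->
  G') :=
  (forall h, H h -> H' (p h)) /\
  forall r, exists s, forall x y, H x -> H y -> vd x y <= r ->
    vd (p x) (p y) <= s.

Definition coarse_inverse (G G' : fgGroup) (H : set G) (p : G ->
  G') (q : G' -> G) :=
  exists s, forall x, H x -> vd x (q (p x)) <= s.

(** The image under [p] of a chain from the identity to [q g] ends at [p (q g)], near [g]. *)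
Lemma fin_gen_coarse (G G' : fgGroup) (H : set G) (H' : set G') p q :
  subgroup H -> subgroup H' -> coarse_map H H' p -> coarse_map H' H q ->
  coarse_inverse H' q p -> fin_gen H -> fin_gen H'.
Proof.
move=> sH sH' [pH pr] [qH qr] [s sP] /(fin_gen_linked R sH)[r rP].
have [H'1 HM' HV'] := (subgroupP H').1 sH'; have [r' r'P] := pr r.
apply/(fin_gen_linked R sH').
pose m := Num.max r' (Num.max s (vd 1%g (p 1%g))).
exists m => g Hg; apply: (@linked_trans _ _ _ _ _ _ (p 1%g)).
  apply: linked1 => //; last by rewrite !le_max lexx !orbT.
  by apply: pH; have [] := (subgroupP H).1 sH.
apply: (@linked_trans _ _ _ _ _ _ (p (q g))); last first.
  apply: linked1 => //; first exact/pH/qH.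
  by rewrite vdC; apply: le_trans (sP g Hg) _; rewrite !le_max lexx orbT.
elim: (rP _ (qH g Hg)) => [H1|x y Hx IH Hy xy]; first by apply/linked_refl/pH.
apply: linked_step IH _ _; first exact: pH.
by rewrite le_max r'P //; exact: linked_right Hx.
Qed.

(** Each letter is a step of bounded length, whose image is spelled by at most [N] letters; hence
    control becomes linear. *)
Lemma coarse_map_word (G G' : fgGroup) (H : set G) (H' : set G') p S S' :
  generates S H -> generates S' H' -> coarse_map H H' p ->
  exists N : nat, forall n x y, H x -> is_word S n (x^-1 * y)%g ->
    exists2 m, (m <= N * n)%N & is_word S' m ((p x)^-1 * p y)%g.
Proof.
move=> SH SH' [pH pr]; have [r rP] := generators_bounded R SH.1.
have [H1 HM HV] := (subgroupP H).1 (generated_subgroup SH).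
have [s sP] := pr r; have [N NP] := bounded_word SH' s.
exists N; elim=> [|n IH] x y Hx.
  move=> [w [/size0nil -> _]]; rewrite big_nil => xy.
  have -> : y = x by rewrite -(mulVKg x y) xy mulg1.
  by exists 0%N; rewrite ?muln0 // mulVg; exact: is_word0.
move=> /is_word_splitl[z [h [Sz hn xyE]]].
have Hxz : H (x * z)%g by apply: HM => //; exact: generator_in Sz.
have [|m mN wm] := IH (x * z)%g y Hxz.
  by rewrite invgM -mulgA xyE mulKg.
have [|l lN wl] := NP (p x) (p (x * z)%g) (pH _ Hx) (pH _ Hxz).
  by apply: sP => //; rewrite -{1}(mulg1 x) vdM rP.
exists (l + m)%N; first by rewrite mulnS leq_add.
have -> : ((p x)^-1 * p y = ((p x)^-1 * p (x * z)) * ((p (x * z))^-1 * p y))%g.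
  by rewrite -mulgA mulVKg.
exact: is_wordM.
Qed.

Lemma qi_coarse (G G' : fgGroup) (H : set G) (H' : set G') p q :
  coarse_map H H' p -> coarse_map H' H q ->
  coarse_inverse H p q -> coarse_inverse H' q p -> qi_subgroups R H H'.
Proof.
move=> cp cq [s sP] [s' s'P] S S' SH SH'.
have [N NP] := coarse_map_word SH SH' cp.
have [M MP] := coarse_map_word SH' SH cq.
have [K KP] := bounded_word SH s; have [K' KP'] := bounded_word SH' s'.
have [[pH _] [qH _]] := (cp, cq).
pose f (x : H) : H' := SigSub (mem_set (pH _ (set_valP x))).
pose L : R := (N + M + 1)%:R; pose C : R := (N + M + (K + K) + K')%:R.
have up (x y : H) : word_dist R S' (val (f x)) (val (f y)) <=
    N%:R * (word_dist R S (val x) (val y) + 1).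
  have [n wn nl] := word_dist_adherent R SH (set_valP x) (set_valP y).
  have [m mN wm] := NP n _ _ (set_valP x) wn.
  apply: le_trans (word_dist_le R wm) _; apply: (@le_trans _ _ (N%:R * n%:R)).
    by rewrite -natrM ler_nat.
  exact: ler_wpM2l.
have down (x y : H) : word_dist R S (val x) (val y) <=
    M%:R * (word_dist R S' (val (f x)) (val (f y)) + 1) + 2 * K%:R.
  have [n wn nl] := word_dist_adherent R SH' (set_valP (f x)) (set_valP (f y)).
  have [m mM wm] := MP n _ _ (set_valP (f x)) wn.
  have [k kK wk] := KP _ _ (set_valP x) (qH _ (pH _ (set_valP x))) (sP _
    (set_valP x)).
  have [|l lK wl] := KP _ _ (qH _ (pH _ (set_valP y))) (set_valP y).
    by rewrite vdC; exact: sP (set_valP y).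
  have := is_wordM (is_wordM wk wm) wl;
    rewrite !mulgA !mulgK => /word_dist_le/le_trans; apply.
  rewrite !natrD.
  have : k%:R <= K%:R :> R by rewrite ler_nat.
  have : l%:R <= K%:R :> R by rewrite ler_nat.
  have : m%:R <= M%:R * n%:R :> R by rewrite -natrM ler_nat.
  have : M%:R * n%:R <= M%:R * (word_dist R S' (val (f x)) (val (f y)) + 1)
    by exact: ler_wpM2l.
  lra.
have wd0 (x y : H) : 0 <= word_dist R S (val x) (val y).
  have [n wn _] := word_dist_adherent R SH (set_valP x) (set_valP y).
  by apply: lb_le_inf => [|_ [m _ <-]//]; exists n%:R, n.
have wd0' (x y : H) : 0 <= word_dist R S' (val (f x)) (val (f y)).
  have [n wn _] := word_dist_adherent R SH' (set_valP (f x)) (set_valP (f y)).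
  by apply: lb_le_inf => [|_ [m _ <-]//]; exists n%:R, n.
have [N0 M0 K0 K'0] : [/\ 0 <= N%:R :> R, 0 <= M%:R :> R,
  0 <= K%:R :> R & 0 <= K'%:R :> R] by [].
have LE : L = N%:R + M%:R + 1 by rewrite /L !natrD.
have CE : C = N%:R + M%:R + 2 * K%:R + K'%:R by rewrite /C !natrD; lra.
exists f, L, C; split.
- rewrite LE; lra.
- rewrite CE; lra.
- move=> x y; have := up x y; have := down x y; have := wd0 x y;
    have := wd0' x y.
  set d := word_dist _ _ _ _; set d' := word_dist _ _ _ _ => d'0 d0 dd' d'd.
  have Nd : 0 <= N%:R * d by exact: mulr_ge0.
  have Md : 0 <= M%:R * d by exact: mulr_ge0.
  have Nd' : 0 <= N%:R * d' by exact: mulr_ge0.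
  have Md' : 0 <= M%:R * d' by exact: mulr_ge0.
  apply/andP; split; last by rewrite LE CE; lra.
  have L0 : 0 < L by rewrite LE; lra.
  (* As [1 <= L], the additive error survives multiplying the lower bound by [L]. *)
  have LC : C <= L * C by rewrite ler_peMl // LE ?CE; lra.
  rewrite lerBlDr ler_pdivrMl // mulrDr.
  have : M%:R * d' <= L * d' by apply: ler_wpM2r => //; rewrite LE; lra.
  by move: LC; rewrite {1}CE; lra.
- move=> z; exists (SigSub (mem_set (qH _ (set_valP z)))).
  have [m mK wm] := KP' _ _ (set_valP z) (pH _ (qH _ (set_valP z))) (s'P _
    (set_valP z)).
  apply: le_trans (word_dist_le R wm) _; rewrite CE.
  have : m%:R <= K'%:R :> R by rewrite ler_nat.
  lra.
Qed.

End CoarseMap.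

(** [p] moves [phi h] to a nearby element of [H'], and [q] sends [g] to some [h] with [phi h] near
    [g]; the value 1 is a default outside the subgroups. *)
Lemma vertex_qi_coarse (R : realType) (G G' : fgGroup) phi psi (L C t :
  R) (H : set G)
    (H' : set G') : @vertex_qi R G G' phi psi L C ->
  (forall g, H' g -> ~ far (@vd R G') (phi @` H) t g) ->
  (forall a, (phi @` H) a -> ~ far (@vd R G') H' t a) ->
  exists p q, [/\ coarse_map R H H' p, coarse_map R H' H q,
    coarse_inverse R H p q & coarse_inverse R H' q p].
Proof.
move=> [L0 C0 up low _] H'A AH'.
have /choice[p pP] : forall h, exists g, H h -> H' g /\ vd R (phi h) g <= t.
  move=> h; have [Hh|nHh] := pselect (H h); last by exists 1%g.
  have [g Hg hg] := farN (AH' (phi h) (imageP phi Hh)).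
  by exists g.
have /choice[q qP] : forall g, exists h, H' g -> H h /\ vd R g (phi h) <= t.
  move=> g; have [Hg|nHg] := pselect (H' g); last by exists 1%g.
  by have [_ [h Hh <-] gh] := farN (H'A g Hg); exists h.
have near_p h : H h -> H' (p h) /\ vd R (phi h) (p h) <= t by exact: pP.
have near_q g : H' g -> H (q g) /\ vd R g (phi (q g)) <= t by exact: qP.
exists p, q; split.
- split=> [h /near_p[]//|r];
    exists (L * r + C + 2 * t) => x y /near_p[_ xp] /near_p[_ yp] xy.
  have := vd_triangle R (p x) (phi x) (p y);
    have := vd_triangle R (phi x) (phi y) (p y).
  by have := up x y; have := ler_wpM2l L0 xy; rewrite (vdC R (phi x)) in xp;
    lra.
- split=> [h /near_q[]//|r];
    exists (L * (r + 2 * t) + C) => x y /near_q[_ xq] /near_q[_ yq] xy.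
  have qxy : vd R (phi (q x)) (phi (q y)) <= r + 2 * t.
    have := vd_triangle R (phi (q x)) x (phi (q y));
      have := vd_triangle R x y (phi (q y)).
    by rewrite (vdC R x) in xq; lra.
  by have := low (q x) (q y); have := ler_wpM2l L0 qxy; lra.
- exists (L * (2 * t) + C) => x /near_p[Hpx xp]; have [_ pq] := near_q _ Hpx.
  have xq : vd R (phi x) (phi (q (p x))) <= 2 * t.
    by have := vd_triangle R (phi x) (p x) (phi (q (p x))); lra.
  by have := low x (q (p x)); have := ler_wpM2l L0 xq; lra.
- exists (2 * t) => x /near_q[Hqx xq]; have [_ pq] := near_p _ Hqx.
  by have := vd_triangle R x (phi (q x)) (p (q x)); lra.
Qed.

Theorem theorem7p9 (R : realType) (G G' : fgGroup)
  (f : cayley R G -> cayley R G')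
  (f_qi : quasi_isometry (@mdist R (cayley R G)) (@mdist R (cayley R G')) f)
  (H : set G) (H_subgroup : subgroup H)
  (H_coends : (3%:E <= num_coends R H)%E)
  (H_sub_coends : forall K : set G, subgroup K -> K `<=` H ->
    infinite_index K H -> num_coends R K = 1%:E)
  (fH_noncrossing : exists2 R0 : R, 0 <= R0 & forall r : R, R0 <= r ->
    noncrossing (@translate R G') (unif_nbhd r (f @` [set vertex R h | h in H]))) :
  exists H' : set G',
    [/\ subgroup H',
        (hausdorff_dist [set vertex R h | h in H']
           (f @` [set vertex R h | h in H]) < +oo)%E,
        fin_gen H <-> fin_gen H' &
        fin_gen H -> qi_subgroups R H H'].
Proof.
have [phi [psi [L [C [qi phif]]]]] := quasi_isometry_vertex_qi f_qi.
have [c [c_const c_far]] := three_colouring H_coends.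
have [L0 C0 _ _ _] := qi.
set Af := f @` _ in fH_noncrossing *; pose A := phi @` H.
have A_near_Af a : A a -> exists2 p, Af p & mdist p (vertex R a) <= 1.
  by move=> [h Hh <-]; exists (f (vertex R h)) => //;
    exists (vertex R h) => //; exists h.
have Af_near_A p : Af p -> exists2 a, A a & mdist p (vertex R a) <= 1.
  by move=> [_ [h Hh <-] <-]; exists (phi h) => //; exists h.
have c'_const := transfer_colouring qi c_const.
have c'_far := transfer_colours qi c_const c_far.
have A_linked := transfer_far_linked qi (far_linked H_subgroup H_sub_coends).
have rho0 : 0 <= L + C by rewrite addr_ge0.
pose H' := coarse_stab R A (c \o psi).
have [H1 _ _] := (subgroupP H).1 H_subgroup.
have [t [H'A AH']] := coarse_stab_hausdorff A_near_Af Af_near_A c'_const c'_far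
  rho0 A_linked fH_noncrossing (imageP phi H1).
have sH' : subgroup H' by exact: coarse_stab_subgroup.
have [p [q [cp cq pq qp]]] := vertex_qi_coarse qi H'A AH'.
exists H'; split => //.
(* The extra 1 separates [A] from [Af]; the maximum keeps the radius nonnegative. *)
- apply: (@le_lt_trans _ _ (Num.max 0 (t + 1))%:E); last exact: ltry.
  apply: ereal_inf_lbound; exists (Num.max 0 (t + 1)) => //; split.
  + by rewrite le_max lexx.
  + move=> _ [g H'g <-]; have [a Aa ga] := farN (H'A g H'g).
    have [x Afx xa] := A_near_Af a Aa; apply: (unif_nbhd_in Afx).
    rewrite le_max; apply/orP; right; rewrite metric_sym in xa.
    by have := metric_triangle (vertex R g) (vertex R a) x;
      rewrite vdE in ga; lra.
  + move=> x Afx; have [a Aa xa] := Af_near_A x Afx.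
    have [g H'g ag] := farN (AH' a Aa).
    apply: (@unif_nbhd_in _ _ _ _ _ (vertex R g)); first by exists g.
    rewrite le_max; apply/orP; right.
    by have := metric_triangle x (vertex R a) (vertex R g);
      rewrite vdE in ag; lra.
- split; [exact: (fin_gen_coarse H_subgroup sH' cp cq qp)|].
  exact: (fin_gen_coarse sH' H_subgroup cq cp pq).
- by move=> _; exact: qi_coarse cp cq pq qp.
Qed.
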